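(* Let $r\ge2$. The average pairwise geometric fidelity $F_G(\rho_1,\ldots,\rho_r)=\frac{2}{r(r-1)}\sum_{i<j}F_G(\rho_i,\rho_j)$ satisfies the following for all quantum states $\rho_1,\ldots,\rho_r$ on a common space. (i) (Reduction to classical) If $\rho_1,\ldots,\rho_r$ commute pairwise, then $F_G(\rho_1,\ldots,\rho_r)=\frac{2}{r(r-1)}\sum_{i<j}\sum_x\sqrt{\rho_i(x)\rho_j(x)}$, where $(\rho_i(x))_x$ are the eigenvalues of $\rho_i$ in a common eigenbasis. (ii) (Data processing) $F_G(\rho_1,\ldots,\rho_r)\le F_G(\mathcal N(\rho_1),\ldots,\mathcal N(\rho_r))$ for every quantum channel $\mathcal N$. (iii) (Symmetry) $F_G(\rho_1,\ldots,\rho_r)=F_G(\rho_{\pi(1)},\ldots,\rho_{\pi(r)})$ for every permutation $\pi$ of $\{1,\ldots,r\}$. (iv) (Faithfulness) $F_G(\rho_1,\ldots,\rho_r)=1$ if and only if $\rho_i=\rho_j$ for all $i,j$. (v) (Direct-sum property) For every finite alphabet $\mathcal X$, probability distribution $(p(x))_{x\in\mathcal X}$ and states $(\rho_i^x)_{x\in\mathcal X}$, $i=1,\ldots,r$, $$F_G\Big(\sum_xp(x)|x\rangle\langle x|\otimes\rho_1^x,\ldots,\sum_xp(x)|x\rangle\langle x|\otimes\rho_r^x\Big)=\sum_xp(x)F_G(\rho_1^x,\ldots,\rho_r^x).$$ (vi) (Super-multiplicativity) $(F_G(\rho_1,\ldots,\rho_r))^n\le F_G(\rho_1^{\otimes n},\ldots,\rho_r^{\otimes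 n})$ for every integer $n\ge1$. (vii) (Coarse-graining) For every $m\in\mathbb N$ and all states $\rho_1,\ldots,\rho_{r+m}$, $F_G(\rho_1,\ldots,\rho_r)\le\frac{(r+m)(r+m-1)}{r(r-1)}F_G(\rho_1,\ldots,\rho_{r+m})$.
   Context: All Hilbert spaces are finite-dimensional and complex. A quantum state is a positive semi-definite operator of unit trace; a quantum channel is a completely positive trace-preserving linear map (input and output dimensions may differ). The geometric (Matsumoto) fidelity of two states is $F_G(\rho,\sigma)=\inf_{\varepsilon>0}\operatorname{Tr}[(\rho+\varepsilon I)\#(\sigma+\varepsilon I)]$, where for positive definite $A,B$ the matrix geometric mean is $A\#B=A^{1/2}(A^{-1/2}BA^{-1/2})^{1/2}A^{1/2}$. $\{|x\rangle\}_{x\in\mathcal X}$ is an orthonormal basis of $\mathbb C^{|\mathcal X|}$. *)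

(* Defs.v *)
(* Complex matrices are over R[i], for R : realType. *)
From HB Require Import structures.
From mathcomp Require Import all_boot all_order all_algebra all_fingroup.
From mathcomp Require Import complex mxtens.
From mathcomp Require Import mathcomp_extra boolp classical_sets reals.

Set Implicit Arguments.
Unset Strict Implicit.
Unset Printing Implicit Defensive.

Import Order.TTheory GRing.Theory Num.Theory.

Local Open Scope ring_scope.
Local Open Scope complex_scope.
Local Open Scope classical_set_scope.

Section Matrices.
Variable R : realType.
Local Notation C := R[i].

Definition adjmx m n (A : 'M[C]_(m, n)) : 'M[C]_(n, m) :=
  map_mx Num.conj A^T.

Definition psdmx n (A : 'M[C]_n) : Prop :=
  A \is hermsymmx /\ forall v : 'cV[C]_n, 0 <= (adjmx v *m A *m v) 0 0.

Definition is_state n (rho : 'M[C]_n) : Prop := psdmx rho /\ \tr rho = 1.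

(* A = P^-1 D P with P unitary and D diagonal, whenever A is normal. *)
Definition sqrtmx n (A : 'M[C]_n) : 'M[C]_n :=
  invmx (spectralmx A) *m diag_mx (map_mx sqrtC (spectral_diag A))
    *m spectralmx A.

Lemma sqrtmxK n (A : 'M[C]_n) :
  A \is normalmx -> sqrtmx A *m sqrtmx A = A.
Proof.
move=> /orthomx_spectralP AE; rewrite [RHS]AE /sqrtmx !mulmxA.
rewrite mulmxK ?spectral_unit //; congr (_ *m _).
rewrite -!mulmxA mulmx_diag; congr (_ *m diag_mx _).
by apply/rowP => i; rewrite !mxE -expr2 sqrtCK.
Qed.

Definition geomeanmx n (A B : 'M[C]_n) : 'M[C]_n :=
  let S := sqrtmx A in
  S *m sqrtmx (invmx S *m B *m invmx S) *m S.

(* For states the trace below is a nonnegative real number, so that taking its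
   real part only serves to land in R, where the infimum lives. *)
Definition geom_fid n (rho sigma : 'M[C]_n) : R :=
  inf [set complex.Re
             (\tr (geomeanmx (rho + e%:C%:M) (sigma + e%:C%:M)))
      | e in [set e : R | 0 < e]].

Definition avg_geom_fid r n (rho : 'I_r -> 'M[C]_n) : R :=
  2 / (r%:R * (r%:R - 1)) *
  \sum_(i < r) \sum_(j < r | (i < j)%N) geom_fid (rho i) (rho j).

(* The columns of U form an orthonormal basis of joint eigenvectors, and
   lambda i x is the eigenvalue of rho i on the x-th of them. *)
Definition common_eigenbasis r n (rho : 'I_r -> 'M[C]_n)
    (U : 'M[C]_n) (lambda : 'I_r -> 'I_n -> R) : Prop :=
  U \is unitarymx /\
  forall i x, rho i *m col x U = (lambda i x)%:C *: col x U.

(* The block of X at (a, b), seeing X as an operator on C^k (x) C^n. *)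
Definition tensblock k n (X : 'M[C]_(k * n)) (a b : 'I_k) : 'M[C]_n :=
  \matrix_(i, j) X (mxtens_index (a, i)) (mxtens_index (b, j)).

(* id_k (x) N *)
Definition ampliation k m n (N : 'M[C]_n -> 'M[C]_m) (X : 'M[C]_(k * n)) :
    'M[C]_(k * m) :=
  \sum_(a < k) \sum_(b < k) delta_mx a b *t N (tensblock X a b).

Lemma ampliation_tens k m n (N : {linear 'M[C]_n -> 'M[C]_m})
    (A : 'M[C]_k) (B : 'M[C]_n) : ampliation N (A *t B) = A *t N B.
Proof.
have blk a b : tensblock (A *t B) a b = A a b *: B.
  by apply/matrixP => i j; rewrite mxE tensmxE mxE.
apply/matrixP => u v.
case: (mxtens_indexP u) => a i; case: (mxtens_indexP v) => b j.
rewrite tensmxE /ampliation summxE (bigD1 a) //= summxE (bigD1 b) //=.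
rewrite big1 ?addr0 => [|b' b'b]; last first.
  by rewrite tensmxE mxE eqxx eq_sym (negPf b'b) mul0r.
rewrite big1 ?addr0 => [|a' a'a]; last first.
  rewrite summxE big1 // => b' _.
  by rewrite tensmxE mxE eq_sym (negPf a'a) mul0r.
by rewrite tensmxE mxE !eqxx mul1r blk linearZ mxE.
Qed.

Definition completely_positive m n (N : 'M[C]_n -> 'M[C]_m) : Prop :=
  forall (k : nat) (X : 'M[C]_(k * n)), psdmx X -> psdmx (ampliation N X).

Definition is_channel m n (N : {linear 'M[C]_n -> 'M[C]_m}) : Prop :=
  completely_positive N /\ forall X : 'M[C]_n, \tr (N X) = \tr X.

(* Orthonormality of #|X| vectors of C^#|X| makes them a basis. *)
Definition orthonormal_basis (X : finType) (ket : X -> 'cV[C]_#|X|) : Prop :=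
  forall x y, (adjmx (ket x) *m ket y) 0 0 = (x == y)%:R.

Definition is_distribution (X : finType) (p : X -> R) : Prop :=
  (forall x, 0 <= p x) /\ \sum_x p x = 1.

Definition cq_state (X : finType) (ket : X -> 'cV[C]_#|X|) (p : X -> R) n
    (rho : X -> 'M[C]_n) : 'M[C]_(#|X| * n) :=
  \sum_x (p x)%:C *: ((ket x *m adjmx (ket x)) *t rho x).

End Matrices.

(* Main.v *)
(* For positive definite A and B, the geometric mean A # B is at once the
   largest Hermitian X for which the block matrix [[A, X], [X, B]] is positive
   semi-definite and the only positive semi-definite solution of the Riccati
   equation G A^-1 G = B.  The maximality makes Tr (A # B) symmetric and
   monotone in (A, B), and nondecreasing under channels, since a 2-positive map
   preserves the positivity of the block matrix; it also bounds Tr (A # B) by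
   Tr (A + B) / 2.  The uniqueness identifies the geometric mean of block
   diagonal, simultaneously diagonal and tensor product matrices.  Everything is
   applied to rho + eps and sigma + eps; the perturbation is absorbed by
   N(1) <= c 1 for channels and by
   (rho + d) (x) (rho' + d) <= rho (x) rho' + (2 d + d^2) 1 for tensor products.
   If F_G(rho, sigma) = 1, then at rho + eps, sigma + eps the block matrix,
   rotated by the Hadamard matrix, has a lower diagonal block of trace O(eps),
   which forces its off-diagonal block rho - sigma to vanish.  The power in the
   super-multiplicativity is pulled inside the average by convexity of x^k. *)

Require Import Defs.
From HB Require Import structures.
From mathcomp Require Import all_boot all_order all_algebra all_fingroup.
From mathcomp Require Import complex mxtens.
From mathcomp Require Import mathcomp_extra boolp classical_sets reals.
From mathcomp Require Import ring lra.

Set Implicit Arguments.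
Unset Strict Implicit.
Unset Printing Implicit Defensive.

Import Order.TTheory GRing.Theory Num.Theory.
Local Open Scope ring_scope.

(** * Positive semi-definite matrices *)

Section Psd.
Variable R : realType.
Local Notation C := R[i].
Local Open Scope complex_scope.

Lemma adjmxK m n (A : 'M[C]_(m, n)) : adjmx (adjmx A) = A.
Proof. exact: trmxCK. Qed.

Lemma adjmxM m n p (A : 'M[C]_(m, n)) (B : 'M[C]_(n, p)) :
  adjmx (A *m B) = adjmx B *m adjmx A.
Proof. by rewrite /adjmx trmx_mul map_mxM. Qed.

Lemma adjmxD m n (A B : 'M[C]_(m, n)) : adjmx (A + B) = adjmx A + adjmx B.
Proof. by rewrite /adjmx linearD /= map_mxD. Qed.

Lemma adjmxN m n (A : 'M[C]_(m, n)) : adjmx (- A) = - adjmx A.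
Proof. by rewrite /adjmx linearN /= map_mxN. Qed.

Lemma adjmxB m n (A B : 'M[C]_(m, n)) : adjmx (A - B) = adjmx A - adjmx B.
Proof. by rewrite adjmxD adjmxN. Qed.

Lemma adjmxZ m n (c : C) (A : 'M[C]_(m, n)) :
  adjmx (c *: A) = c^*%R *: adjmx A.
Proof. by rewrite /adjmx linearZ /= map_mxZ. Qed.

Lemma adjmx_scalar n (c : C) : adjmx (c%:M : 'M_n) = (c^*%R)%:M.
Proof. by rewrite /adjmx tr_scalar_mx map_scalar_mx. Qed.

Lemma adjmx1 n : adjmx (1%:M : 'M[C]_n) = 1%:M.
Proof. by rewrite adjmx_scalar rmorph1. Qed.

Lemma adjmx0 m n : adjmx (0 : 'M[C]_(m, n)) = 0.
Proof. by rewrite /adjmx trmx0 map_mx0. Qed.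

Lemma adjmx_inv n (A : 'M[C]_n) : adjmx (invmx A) = invmx (adjmx A).
Proof. by rewrite /adjmx trmx_inv map_invmx. Qed.

Lemma adjmx_tens m n p q (A : 'M[C]_(m, n)) (B : 'M[C]_(p, q)) :
  adjmx (A *t B) = adjmx A *t adjmx B.
Proof. by rewrite /adjmx trmx_tens map_mxT. Qed.

Lemma adjmx_delta m n (i : 'I_m) (j : 'I_n) :
  adjmx (delta_mx i j : 'M[C]_(m, n)) = delta_mx j i.
Proof. by rewrite /adjmx trmx_delta map_delta_mx. Qed.

Lemma realc_conj (e : R) : (e%:C)^*%R = e%:C.
Proof. by apply: conj_Creal; apply/complex_realP; exists e. Qed.

Lemma hermsymmxP n (A : 'M[C]_n) : A \is hermsymmx <-> adjmx A = A.
Proof.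
split=> [/is_hermitianmxP h|h]; first by rewrite [RHS]h expr0 scale1r.
by apply/is_hermitianmxP; rewrite expr0 scale1r -[LHS]h.
Qed.

Definition qform n (A : 'M[C]_n) (u v : 'cV[C]_n) : C :=
  (adjmx u *m A *m v) 0 0.

Lemma qformD n (A B : 'M[C]_n) u v :
  qform (A + B) u v = qform A u v + qform B u v.
Proof. by rewrite /qform mulmxDr mulmxDl mxE. Qed.

Lemma qformN n (A : 'M[C]_n) u v : qform (- A) u v = - qform A u v.
Proof. by rewrite /qform mulmxN mulNmx mxE. Qed.

Lemma qformB n (A B : 'M[C]_n) u v :
  qform (A - B) u v = qform A u v - qform B u v.
Proof. by rewrite qformD qformN. Qed.

Lemma qformZ n c (A : 'M[C]_n) u v : qform (c *: A) u v = c * qform A u v.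
Proof. by rewrite /qform -scalemxAr -scalemxAl mxE. Qed.

Lemma qformMl n (P A : 'M[C]_n) u v :
  qform A (P *m u) v = qform (adjmx P *m A) u v.
Proof. by rewrite /qform adjmxM !mulmxA. Qed.

Lemma qformMr n (P A : 'M[C]_n) u v : qform A u (P *m v) = qform (A *m P) u v.
Proof. by rewrite /qform !mulmxA. Qed.

Lemma qformNl n (A : 'M[C]_n) u v : qform A (- u) v = - qform A u v.
Proof. by rewrite /qform adjmxN !mulNmx mxE. Qed.

Lemma qformNr n (A : 'M[C]_n) u v : qform A u (- v) = - qform A u v.
Proof. by rewrite /qform !mulmxN mxE. Qed.

Lemma qformDl n (A : 'M[C]_n) u u' v :
  qform A (u + u') v = qform A u v + qform A u' v.
Proof. by rewrite /qform adjmxD !mulmxDl mxE. Qed.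

Lemma qformDr n (A : 'M[C]_n) u v v' :
  qform A u (v + v') = qform A u v + qform A u v'.
Proof. by rewrite /qform !mulmxDr mxE. Qed.

Lemma qformZl n (A : 'M[C]_n) c u v : qform A (c *: u) v = c^*%R * qform A u v.
Proof. by rewrite /qform adjmxZ -!scalemxAl mxE. Qed.

Lemma qformZr n (A : 'M[C]_n) c u v : qform A u (c *: v) = c * qform A u v.
Proof. by rewrite /qform -!scalemxAr mxE. Qed.

Lemma norm_col_ge0 m (w : 'cV[C]_m) : 0 <= (adjmx w *m w) 0 0.
Proof.
by rewrite mxE sumr_ge0 // => i _; rewrite !mxE mulrC mul_conjC_ge0.
Qed.

Lemma norm_col_eq0 m (w : 'cV[C]_m) : (adjmx w *m w) 0 0 = 0 -> w = 0.
Proof.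
rewrite mxE => /eqP; rewrite psumr_eq0; last first.
  by move=> i _; rewrite !mxE mulrC mul_conjC_ge0.
move=> /allP h; apply/colP => i; rewrite mxE.
have /= := h i (mem_index_enum _).
by rewrite !mxE mulf_eq0 conjC_eq0 orbb => /eqP.
Qed.

Lemma psdmx_gram m n (P : 'M[C]_(m, n)) : psdmx (adjmx P *m P).
Proof.
split=> [|v]; first by apply/hermsymmxP; rewrite adjmxM adjmxK.
have -> : adjmx v *m (adjmx P *m P) *m v = adjmx (P *m v) *m (P *m v).
  by rewrite adjmxM !mulmxA.
exact: norm_col_ge0.
Qed.

Lemma psdmx_herm n (A : 'M[C]_n) : psdmx A -> adjmx A = A.
Proof. by case=> /hermsymmxP. Qed.

Lemma psdmx_ge0 n (A : 'M[C]_n) v : psdmx A -> 0 <= qform A v v.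
Proof. by case=> _; apply. Qed.

Lemma psdmxI n (A : 'M[C]_n) :
  adjmx A = A -> (forall v, 0 <= qform A v v) -> psdmx A.
Proof. by move=> h q; split=> //; apply/hermsymmxP. Qed.

Lemma psdmx_conj m n (P : 'M[C]_(m, n)) (A : 'M[C]_m) :
  psdmx A -> psdmx (adjmx P *m A *m P).
Proof.
move=> pA; split.
  by apply/hermsymmxP; rewrite !adjmxM adjmxK (psdmx_herm pA) mulmxA.
move=> v; have -> : adjmx v *m (adjmx P *m A *m P) *m v =
    adjmx (P *m v) *m A *m (P *m v) by rewrite adjmxM !mulmxA.
by case: pA.
Qed.

Lemma psdmxD n (A B : 'M[C]_n) : psdmx A -> psdmx B -> psdmx (A + B).
Proof.
move=> pA pB; apply: psdmxI; first by rewrite adjmxD !psdmx_herm.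
by move=> v; rewrite qformD addr_ge0 ?psdmx_ge0.
Qed.

Lemma psdmxZ n c (A : 'M[C]_n) : 0 <= c -> psdmx A -> psdmx (c *: A).
Proof.
move=> c0 pA; apply: psdmxI.
  by rewrite adjmxZ (psdmx_herm pA) conj_Creal ?ger0_real.
by move=> v; rewrite qformZ mulr_ge0 ?psdmx_ge0.
Qed.

Lemma psdmx0 n : psdmx (0 : 'M[C]_n).
Proof.
apply: psdmxI => [|v]; first by rewrite adjmx0.
by rewrite /qform mulmx0 mul0mx mxE.
Qed.

Lemma psdmx1 n : psdmx (1%:M : 'M[C]_n).
Proof. by rewrite -[1%:M]mulmx1 -{1}adjmx1; apply: psdmx_gram. Qed.

Lemma psdmx_scalar n c : 0 <= c -> psdmx (c%:M : 'M[C]_n).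
Proof. by move=> c0; rewrite -scalemx1; apply/psdmxZ/psdmx1. Qed.

Lemma psdmx_sum n (I : Type) (s : seq I) (P : pred I) (F : I -> 'M[C]_n) :
  (forall i, P i -> psdmx (F i)) -> psdmx (\sum_(i <- s | P i) F i).
Proof.
by move=> h; elim/big_ind: _ => //; [exact: psdmx0 | exact: psdmxD].
Qed.

Lemma psdmx_diag n (d : 'rV[C]_n) :
  (forall i, 0 <= d 0 i) -> psdmx (diag_mx d).
Proof.
move=> d0; apply: psdmxI.
  apply/matrixP => i j; rewrite !mxE rmorphMn /= eq_sym.
  by case: eqP => [->|//]; rewrite mulr1n conj_Creal // ger0_real.
move=> v; rewrite /qform mul_mx_diag mxE sumr_ge0 // => i _.
by rewrite !mxE mulrAC mulr_ge0 // mulrC mul_conjC_ge0.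
Qed.

Lemma spectralE n (A : 'M[C]_n) : adjmx A = A ->
  A = adjmx (spectralmx A) *m diag_mx (spectral_diag A) *m spectralmx A.
Proof.
move=> /hermsymmxP/hermitian_normalmx/orthomx_spectralP {1}->.
by rewrite invmx_unitary // spectral_unitarymx.
Qed.

Lemma spectralmxK n (A : 'M[C]_n) :
  spectralmx A *m adjmx (spectralmx A) = 1%:M.
Proof. exact/unitarymxP/spectral_unitarymx. Qed.

(** The columns of the adjoint of [spectralmx A] are orthonormal eigenvectors; this gives access to
    one eigenvalue at a time through a unit vector. *)
Lemma qform_spectral n (A : 'M[C]_n) i : adjmx A = A ->
  let v := adjmx (spectralmx A) *m (delta_mx i 0 : 'cV[C]_n) in
  A *m v = spectral_diag A 0 i *: v /\ (adjmx v *m v) 0 0 = 1.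
Proof.
move=> hA v; split.
  rewrite /v {1}(spectralE hA) -!mulmxA (mulmxA (spectralmx A)) spectralmxK.
  rewrite mul1mx scalemxAr; congr (_ *m _).
  apply/colP => j; rewrite mul_diag_mx !mxE.
  by case: eqP => [->|]; rewrite ?mulr0.
rewrite /v adjmxM adjmxK -mulmxA (mulmxA (spectralmx A)) spectralmxK mul1mx.
rewrite mxE (bigD1 i) //= !mxE !eqxx rmorph1 mulr1 big1 ?addr0 // => j ji.
by rewrite !mxE (negPf ji) mulr0.
Qed.

Lemma psdmx_spectral_ge0 n (A : 'M[C]_n) i :
  psdmx A -> 0 <= spectral_diag A 0 i.
Proof.
move=> pA; have [Av v1] := qform_spectral i (psdmx_herm pA).
have := psdmx_ge0 (adjmx (spectralmx A) *m (delta_mx i 0 : 'cV[C]_n)) pA.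
by rewrite /qform -mulmxA Av -scalemxAr mxE v1 mulr1.
Qed.

Lemma sqrtmxE n (A : 'M[C]_n) : sqrtmx A =
  adjmx (spectralmx A) *m diag_mx (map_mx sqrtC (spectral_diag A))
    *m spectralmx A.
Proof. by rewrite /sqrtmx invmx_unitary // spectral_unitarymx. Qed.

Lemma sqrtmx_psd n (A : 'M[C]_n) : psdmx A -> psdmx (sqrtmx A).
Proof.
move=> pA; rewrite sqrtmxE; apply/psdmx_conj/psdmx_diag => i.
by rewrite mxE sqrtC_ge0 psdmx_spectral_ge0.
Qed.

Lemma sqrtmx_sqr n (A : 'M[C]_n) : psdmx A -> sqrtmx A *m sqrtmx A = A.
Proof. by case=> /hermitian_normalmx/sqrtmxK. Qed.

Lemma psdmxP n (A : 'M[C]_n) :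
  psdmx A -> exists P : 'M[C]_n, A = adjmx P *m P.
Proof.
move=> pA; exists (sqrtmx A).
by rewrite (psdmx_herm (sqrtmx_psd pA)) sqrtmx_sqr.
Qed.

(** A tensor product of Gram matrices is the Gram matrix of the tensor product. *)
Lemma psdmx_tens m n (A : 'M[C]_m) (B : 'M[C]_n) :
  psdmx A -> psdmx B -> psdmx (A *t B).
Proof.
move=> /psdmxP[P ->] /psdmxP[Q ->].
by rewrite -tensmx_mul -adjmx_tens; apply: psdmx_gram.
Qed.

Lemma mxtrace_gram m n (P : 'M[C]_(m, n)) : 0 <= \tr (adjmx P *m P).
Proof.
rewrite sumr_ge0 // => i _; rewrite mxE sumr_ge0 // => j _.
by rewrite !mxE mulrC mul_conjC_ge0.
Qed.

Lemma mxtrace_psd n (A : 'M[C]_n) : psdmx A -> 0 <= \tr A.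
Proof. by move=> /psdmxP[P ->]; apply: mxtrace_gram. Qed.

(** With A = P^* P, the two signs force |P v|^2 = 0 for every v. This turns two opposite operator
    inequalities into an equality. *)
Lemma psdmx_anti n (A : 'M[C]_n) : psdmx A -> psdmx (- A) -> A = 0.
Proof.
move=> pA pN; have [P AE] := psdmxP pA.
have P0 (v : 'cV[C]_n) : P *m v = 0.
  apply: norm_col_eq0.
  rewrite adjmxM !mulmxA -(mulmxA _ (adjmx P)) -AE -/(qform _ _ _).
  apply/eqP; rewrite eq_le psdmx_ge0 // andbT -oppr_ge0 -qformN.
  exact: psdmx_ge0.
rewrite AE (_ : P = 0) ?mulmx0 //; apply/matrixP => i j.
by have /colP/(_ i) := P0 (delta_mx j 0); rewrite -colE !mxE.
Qed.

(** Each eigenvalue is at most the sum of all of them, since they are nonnegative. This crude norm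
    bound gives X <= 1 for states and N(1) <= Tr N(1) for channels. *)
Lemma psdmx_le_trace n (A : 'M[C]_n) : psdmx A -> psdmx ((\tr A)%:M - A).
Proof.
move=> pA; set t := \tr A; pose d := spectral_diag A; pose U := spectralmx A.
have AE := spectralE (psdmx_herm pA).
have UU : adjmx U *m U = 1%:M by apply/mulmx1C/spectralmxK.
have tE : t = \sum_i d 0 i.
  by rewrite /t {1}AE mxtrace_mulC mulmxA spectralmxK mul1mx mxtrace_diag.
have -> : t%:M - A = adjmx U *m (diag_mx (const_mx t - d)) *m U.
  rewrite linearB /= mulmxBr mulmxBl -AE; congr (_ - _).
  by rewrite diag_const_mx -scalemx1 -scalemxAr mulmx1 -scalemxAl UU scalemx1.
apply/psdmx_conj/psdmx_diag => i; rewrite !mxE tE (bigD1 i) //= addrAC subrr.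
by rewrite add0r sumr_ge0 // => j _; apply: psdmx_spectral_ge0.
Qed.

(** Definiteness is stated through invertibility because only the inverse of A enters the Riccati
    equation. *)
Definition pdmx n (A : 'M[C]_n) := psdmx A /\ A \in unitmx.

Lemma unitmx_ker n (A : 'M[C]_n) :
  (forall v : 'cV_n, A *m v = 0 -> v = 0) -> A \in unitmx.
Proof.
move=> h; rewrite -unitmx_tr -row_free_unit -kermx_eq0;
  apply/eqP/row_matrixP => i.
rewrite row0; apply: trmx_inj; rewrite trmx0; apply: h.
apply: trmx_inj; rewrite trmx_mul trmxK trmx0.
by rewrite -row_mul mulmx_ker row0.
Qed.

(** If (A + e) v = 0, then e |v|^2 = - <v, A v> <= 0, so v = 0. *)
Lemma pdmxDscalar n (A : 'M[C]_n) (e : R) :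
  psdmx A -> 0 < e -> pdmx (A + e%:C%:M).
Proof.
move=> pA e0; have e0' : 0 < e%:C by rewrite ltcR.
split; first by apply/psdmxD/psdmx_scalar => //; apply: ltW.
apply: unitmx_ker => v /(congr1 (fun x => (adjmx v *m x) 0 0)).
rewrite mulmxDl mulmxDr mulmx0 mxE [RHS]mxE mul_scalar_mx -scalemxAr.
rewrite [X in _ + X]mxE mulmxA -/(qform A v v) => h; apply: norm_col_eq0.
have h1 := psdmx_ge0 v pA; have h2 := norm_col_ge0 v.
apply/eqP; rewrite eq_le h2 andbT -(pmulr_rle0 _ e0').
by move: h => /eqP; rewrite addrC addr_eq0 => /eqP ->; rewrite oppr_le0.
Qed.

(* The square root is operator monotone, in the form: [Y^2 <= T^2] forces
   [Y <= T].  An eigenvector [v] of [T - Y] with eigenvalue [d < 0] would give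
   [|Yv|^2 = |Tv|^2 - 2 d <v, T v> + d^2 |v|^2 > |Tv|^2]. *)
Lemma psdmx_sqrt_le n (Y T : 'M[C]_n) : adjmx Y = Y -> psdmx T ->
  psdmx (T *m T - Y *m Y) -> psdmx (T - Y).
Proof.
move=> hY pT hle; have hT := psdmx_herm pT.
have hM : adjmx (T - Y) = T - Y by rewrite adjmxB hT hY.
rewrite (spectralE hM); apply/psdmx_conj/psdmx_diag => i.
set d := spectral_diag _ 0 i.
have dR : d \is Num.real.
  by have /hermsymmxP/hermitian_spectral_diag_real/mxOverP := hM; apply.
have [v [Mv v1]] : exists v : 'cV[C]_n,
    (T - Y) *m v = d *: v /\ (adjmx v *m v) 0 0 = 1.
  by eexists; exact: qform_spectral.
have Yv : Y *m v = T *m v - d *: v.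
  by rewrite -Mv mulmxBl opprB addrC subrK.
rewrite real_leNgt // ?real0 //; apply/negP => d0.
have b0 := psdmx_ge0 v pT.
have E : qform (Y *m Y) v v =
    qform (T *m T) v v - (d * qform T v v + d * qform T v v - d * d).
  rewrite -{1}hY -qformMl.
  have -> : qform Y (Y *m v) v = (adjmx (Y *m v) *m (Y *m v)) 0 0.
    by rewrite /qform -!mulmxA.
  rewrite Yv adjmxB adjmxZ (conj_Creal dR) adjmxM hT mulmxBl !mulmxBr.
  rewrite -!scalemxAl -!scalemxAr !mulmxA -(mulmxA _ T T).
  have addE (X Z : 'M[C]_1) : (X - Z) 0 0 = X 0 0 - Z 0 0 by rewrite !mxE.
  have scE (c : C) (X : 'M[C]_1) : (c *: X) 0 0 = c * X 0 0 by rewrite mxE.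
  rewrite !(addE, scE) v1 mulr1 -!/(qform _ _ _).
  ring.
have neg : d * qform T v v + d * qform T v v - d * d < 0.
  rewrite subr_lt0; apply: (@le_lt_trans _ _ 0); last by rewrite nmulr_rgt0.
  by rewrite -mulr2n pmulrn_lle0 // nmulr_rle0.
have := psdmx_ge0 v hle; rewrite qformB E opprB addrC subrK.
by rewrite (lt_geF neg).
Qed.
End Psd.

(** * The matrix geometric mean *)

Section Geo.
Variable R : realType.
Local Notation C := R[i].
Local Open Scope complex_scope.

(* Positivity of the block matrix [[A, X], [X, B]], tested on vectors (u, v). *)
Definition gfeas n (A B X : 'M[C]_n) : Prop :=
  adjmx X = X /\
  forall u v, 0 <= qform A u u + qform X u v + qform X v u + qform B v v.

Lemma gfeas_sym n (A B X : 'M[C]_n) : gfeas A B X -> gfeas B A X.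
Proof.
move=> [hX h]; split=> // u v; have := h v u.
by rewrite [X in 0 <= X -> _](_ : _ = qform B u u + qform X u v + qform X v u
  + qform A v v) //; ring.
Qed.

Lemma gfeas_mono n (A B A' B' X : 'M[C]_n) :
  psdmx (A' - A) -> psdmx (B' - B) -> gfeas A B X -> gfeas A' B' X.
Proof.
move=> pA pB [hX h]; split=> // u v.
have := addr_ge0 (addr_ge0 (psdmx_ge0 u pA) (psdmx_ge0 v pB)) (h u v).
rewrite !qformB.
by rewrite [X in 0 <= X -> _](_ : _ = qform A' u u + qform X u v + qform X v u
  + qform B' v v) //; ring.
Qed.

(** For fixed v the block form is minimal at u = - A^-1 X v, where its value is that of the Schur
    complement. *)
Lemma gfeas_schur n (A B X : 'M[C]_n) : pdmx A -> psdmx B ->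
  gfeas A B X -> psdmx (B - X *m invmx A *m X).
Proof.
move=> [pA uA] pB [hX h]; have hA := psdmx_herm pA.
apply: psdmxI => [|v].
  by rewrite adjmxB !adjmxM adjmx_inv hA hX (psdmx_herm pB) mulmxA.
have := h (- (invmx A *m (X *m v))) v.
rewrite !(qformNl, qformNr) opprK qformB.
have -> : qform A (invmx A *m (X *m v)) (invmx A *m (X *m v)) =
    qform (X *m invmx A *m X) v v.
  by rewrite /qform !adjmxM adjmx_inv hA hX !mulmxA mulmxKV.
have -> : qform X (invmx A *m (X *m v)) v = qform (X *m invmx A *m X) v v.
  by rewrite /qform !adjmxM adjmx_inv hA hX !mulmxA.
have -> : qform X v (invmx A *m (X *m v)) = qform (X *m invmx A *m X) v v.
  by rewrite /qform !mulmxA.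
by rewrite subrr add0r addrC.
Qed.

(** Completing the square: under the Riccati equation the block form at (u, v) is the form of A at u
    + A^-1 G v. *)
Lemma gfeas_riccati n (A B G : 'M[C]_n) : pdmx A -> adjmx G = G ->
  G *m invmx A *m G = B -> gfeas A B G.
Proof.
move=> [pA uA] hG e; split=> // u v; have hA := psdmx_herm pA.
have := psdmx_ge0 (u + invmx A *m G *m v) pA.
rewrite qformDl !qformDr -mulmxA.
have -> : qform A u (invmx A *m (G *m v)) = qform G u v.
  by rewrite qformMr mulmxV // qformMr mul1mx.
have -> : qform A (invmx A *m (G *m v)) (invmx A *m (G *m v)) = qform B v v.
  by rewrite qformMl adjmx_inv hA mulVmx // qformMl hG mulmx1 !qformMr -e.
have -> : qform A (invmx A *m (G *m v)) u = qform G v u.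
  by rewrite qformMl adjmx_inv hA mulVmx // qformMl hG mulmx1.
by rewrite !addrA.
Qed.

(** Collects the facts about S = A^(1/2) and the inner root T on which the later arguments rest, so
    that the spectral definition of the root is not opened again. *)
Lemma geomeanmx_factor n (A B : 'M[C]_n) : pdmx A -> psdmx B ->
  exists S T : 'M[C]_n,
    [/\ adjmx S = S, S \in unitmx, invmx A = invmx S *m invmx S, psdmx T &
        T *m T = invmx S *m B *m invmx S /\ geomeanmx A B = S *m T *m S].
Proof.
move=> [pA uA] pB.
have SS := sqrtmx_sqr pA; have hS := psdmx_herm (sqrtmx_psd pA).
move GE : (geomeanmx A B) => G; rewrite /geomeanmx in GE.
move: (sqrtmx A) SS hS GE => /= S SS hS <-.
have uS : S \in unitmx by move: uA; rewrite -SS unitmx_mul => /andP[].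
have pSBS : psdmx (invmx S *m B *m invmx S).
  by rewrite -{1}hS -adjmx_inv; apply: psdmx_conj.
exists S, (sqrtmx (invmx S *m B *m invmx S)); split=> //.
- apply: (can_inj (mulKmx uA)).
  by rewrite mulmxV // -SS mulmxA mulmxK // mulmxV.
- exact: sqrtmx_psd.
- by rewrite sqrtmx_sqr.
Qed.

Lemma geomeanmx_psd n (A B : 'M[C]_n) :
  pdmx A -> psdmx B -> psdmx (geomeanmx A B).
Proof.
move=> pA pB; have [S [T [hS _ _ pT [_ ->]]]] := geomeanmx_factor pA pB.
by rewrite -{1}hS; apply: psdmx_conj.
Qed.

Lemma geomeanmx_riccati n (A B : 'M[C]_n) : pdmx A -> psdmx B ->
  geomeanmx A B *m invmx A *m geomeanmx A B = B.
Proof.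
move=> pA pB; have [S [T [_ uS AV _ [TT ->]]]] := geomeanmx_factor pA pB.
rewrite AV !mulmxA mulmxK // -(mulmxA _ (invmx S) S) mulVmx // mulmx1.
by rewrite -(mulmxA S T T) TT !mulmxA mulmxV // mul1mx mulmxKV.
Qed.

Lemma geomeanmx_gfeas n (A B : 'M[C]_n) : pdmx A -> psdmx B ->
  gfeas A B (geomeanmx A B).
Proof.
move=> pA pB; apply: (gfeas_riccati pA _ (geomeanmx_riccati pA pB)).
exact/psdmx_herm/geomeanmx_psd.
Qed.

(** Conjugation by S^-1 turns the Schur complement inequality X A^-1 X <= B into Y^2 <= T^2 with Y =
    S^-1 X S^-1; operator monotonicity of the root then gives Y <= T. *)
Lemma gfeas_le n (A B X : 'M[C]_n) : pdmx A -> psdmx B ->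
  gfeas A B X -> psdmx (geomeanmx A B - X).
Proof.
move=> pA pB fX; have hX : adjmx X = X by case: fX.
have [S [T [hS uS AV pT [TT ->]]]] := geomeanmx_factor pA pB.
have hSV : adjmx (invmx S) = invmx S by rewrite adjmx_inv hS.
pose Y := invmx S *m X *m invmx S.
have XE : X = S *m Y *m S by rewrite /Y !mulmxA mulmxV // mul1mx mulmxKV.
have -> : S *m T *m S - X = adjmx S *m (T - Y) *m S.
  by rewrite {1}XE hS mulmxBr mulmxBl.
apply/psdmx_conj/psdmx_sqrt_le => //.
  by rewrite /Y !adjmxM hX hSV mulmxA.
have -> : T *m T - Y *m Y =
    adjmx (invmx S) *m (B - X *m invmx A *m X) *m invmx S.
  by rewrite TT /Y AV hSV mulmxBr mulmxBl !mulmxA.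
exact/psdmx_conj/gfeas_schur.
Qed.

(** A solution G is feasible, so maximality bounds it above by the mean. Conversely Y = S^-1 G S^-1
    is positive with Y^2 = T^2, so [psdmx_sqrt_le] with the roles of Y and T exchanged bounds the
    mean by G. *)
Lemma geomeanmx_uniq n (A B G : 'M[C]_n) : pdmx A -> psdmx B ->
  psdmx G -> G *m invmx A *m G = B -> geomeanmx A B = G.
Proof.
move=> pA pB pG e.
have := gfeas_le pA pB (gfeas_riccati pA (psdmx_herm pG) e).
have [S [T [hS uS AV pT [TT ->]]]] := geomeanmx_factor pA pB.
have hSV : adjmx (invmx S) = invmx S by rewrite adjmx_inv hS.
pose Y := invmx S *m G *m invmx S.
have GY : G = S *m Y *m S by rewrite /Y !mulmxA mulmxV // mul1mx mulmxKV.
move=> pD; apply/eqP; rewrite -subr_eq0; apply/eqP/psdmx_anti => //.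
have -> : - (S *m T *m S - G) = adjmx S *m (Y - T) *m S.
  by rewrite opprB {1}GY hS mulmxBr mulmxBl.
apply/psdmx_conj/psdmx_sqrt_le; first exact: psdmx_herm.
  by rewrite /Y -{1}hSV; apply: psdmx_conj.
by rewrite TT -e /Y AV !mulmxA subrr; exact: psdmx0.
Qed.

(** The mean of the smaller pair stays feasible for the larger one, whose mean is maximal. *)
Lemma geomeanmx_mono n (A B A' B' : 'M[C]_n) : pdmx A -> psdmx B ->
  pdmx A' -> psdmx B' -> psdmx (A' - A) -> psdmx (B' - B) ->
  \tr (geomeanmx A B) <= \tr (geomeanmx A' B').
Proof.
move=> pA pB pA' pB' dA dB; rewrite -subr_ge0 -linearB.
apply/mxtrace_psd/gfeas_le => //; apply: gfeas_mono dA dB _.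
exact: geomeanmx_gfeas.
Qed.

(** Feasibility is symmetric in A and B, so each of the two means dominates the other. *)
Lemma geomeanmxC n (A B : 'M[C]_n) : pdmx A -> pdmx B ->
  geomeanmx A B = geomeanmx B A.
Proof.
move=> pA pB; apply/eqP; rewrite -subr_eq0; apply/eqP/psdmx_anti.
  by apply: gfeas_le => //; [case: pB | apply/gfeas_sym/geomeanmx_gfeas => //;
    case: pA].
rewrite opprB.
by apply: gfeas_le => //; [case: pA | apply/gfeas_sym/geomeanmx_gfeas => //;
  case: pB].
Qed.

Lemma geomeanmxZ n c (A B : 'M[C]_n) : 0 < c -> pdmx A -> psdmx B ->
  geomeanmx (c *: A) (c *: B) = c *: geomeanmx A B.
Proof.
move=> c0 pA pB; have [pA' uA] := pA; have uc : c \is a GRing.unit by rewrite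
  unitfE gt_eqF.
apply: geomeanmx_uniq.
- by split; [apply: psdmxZ => //; apply: ltW | rewrite unitmxZ].
- by apply: psdmxZ => //; apply: ltW.
- by apply: psdmxZ (geomeanmx_psd _ _) => //; apply: ltW.
rewrite invmxZ ?unitmxZ // -!scalemxAl -!scalemxAr -!scalemxAl geomeanmx_riccati
  //.
by rewrite !scalerA divrr // mulr1.
Qed.
End Geo.

(** * The geometric fidelity *)

Section Fid.
Variable R : realType.
Local Notation C := R[i].
Local Open Scope complex_scope.

Lemma ler_Re (x y : C) : x <= y -> complex.Re x <= complex.Re y.
Proof. by rewrite lecE => /andP[]. Qed.

Lemma ReD (x y : C) : complex.Re (x + y) = complex.Re x + complex.Re y.
Proof. by case: x y => [a b] [c d]. Qed.

Lemma ReZ (a : R) (x : C) : complex.Re (a%:C * x) = a * complex.Re x.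
Proof. by case: x => [b c] /=; rewrite mul0r subr0. Qed.

Lemma Re_sum (I : Type) (s : seq I) (P : pred I) (F : I -> C) :
  complex.Re (\sum_(i <- s | P i) F i) = \sum_(i <- s | P i) complex.Re (F i).
Proof. exact: (big_morph _ ReD). Qed.

Lemma ReM_ge0 (x y : C) : 0 <= x -> 0 <= y ->
  complex.Re (x * y) = complex.Re x * complex.Re y.
Proof.
move=> /ger0_Im; case: x => [a b] /= -> /ger0_Im; case: y => [c d] /= ->.
by rewrite mulr0 subr0.
Qed.

(** The function of e whose infimum over e > 0 is [geom_fid A B]. *)
Definition fid_eps n (A B : 'M[C]_n) (e : R) : R :=
  complex.Re (\tr (geomeanmx (A + e%:C%:M) (B + e%:C%:M))).

Lemma psdmx_shift n (X : 'M[C]_n) (e e' : R) : e <= e' ->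
  psdmx (X + e'%:C%:M - (X + e%:C%:M)).
Proof.
move=> ee'; have -> : X + e'%:C%:M - (X + e%:C%:M) = (e' - e)%:C%:M.
  by rewrite opprD addrACA subrr add0r rmorphB /= raddfB.
by apply: psdmx_scalar; rewrite ler0c subr_ge0.
Qed.

Section Bounds.
Variables (n : nat) (A B : 'M[C]_n).
Hypotheses (pA : psdmx A) (pB : psdmx B).

Lemma fid_eps_ge0 e : 0 < e -> 0 <= fid_eps A B e.
Proof.
move=> e0; apply: (@ler_Re 0); apply/mxtrace_psd/geomeanmx_psd.
  exact: pdmxDscalar.
by have [] := pdmxDscalar pB e0.
Qed.

Lemma fid_eps_mono e e' : 0 < e -> e <= e' -> fid_eps A B e <= fid_eps A B e'.
Proof.
move=> e0 ee'; have e'0 := lt_le_trans e0 ee'.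
have [pBe _] := pdmxDscalar pB e0; have [pBe' _] := pdmxDscalar pB e'0.
have h := geomeanmx_mono (pdmxDscalar pA e0) pBe (pdmxDscalar pA e'0) pBe'
  (psdmx_shift A ee') (psdmx_shift B ee').
exact: ler_Re h.
Qed.

Lemma geom_fid_le e : 0 < e -> geom_fid A B <= fid_eps A B e.
Proof.
move=> e0; apply: ge_inf; last by exists e.
by exists 0 => _ [e' /= e'0 <-]; apply: fid_eps_ge0.
Qed.

Lemma geom_fid_ge L : (forall e, 0 < e -> L <= fid_eps A B e) ->
  L <= geom_fid A B.
Proof.
move=> h; apply: lb_le_inf; first by exists (fid_eps A B 1); exists 1 => //=.
by move=> _ [e /= e0 <-]; apply: h.
Qed.

Lemma geom_fid_ge0 : 0 <= geom_fid A B.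
Proof. by apply: geom_fid_ge => e; apply: fid_eps_ge0. Qed.

(** Monotonicity in e extends a single near-optimal e0 to all smaller e, so that several pairs of
    matrices can later share one perturbation. *)
Lemma geom_fid_adherent d : 0 < d ->
  exists2 e0, 0 < e0 &
    forall e, 0 < e -> e <= e0 -> fid_eps A B e < geom_fid A B + d.
Proof.
move=> d0; have [|_ [e0 /= e00 <-] he0] := @inf_adherent R
    [set fid_eps A B e | e in [set e : R | 0 < e]]%classic d d0.
  split; first by exists (fid_eps A B 1); exists 1 => //=.
  by exists 0 => _ [e' /= e'0 <-]; apply: fid_eps_ge0.
exists e0 => [//|e ep ee0]; apply: le_lt_trans he0; exact: fid_eps_mono.
Qed.

Lemma geom_fid_eq L : (forall e, 0 < e -> L <= fid_eps A B e) ->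
  (forall d, 0 < d -> exists2 e, 0 < e & fid_eps A B e <= L + d) ->
  geom_fid A B = L.
Proof.
move=> h1 h2; apply/eqP; rewrite eq_le geom_fid_ge // andbT.
apply/ler_addgt0Pr => d /h2[e e0 he]; apply: le_trans he; exact: geom_fid_le.
Qed.

End Bounds.

Lemma fid_epsC n (A B : 'M[C]_n) e : psdmx A -> psdmx B -> 0 < e ->
  fid_eps A B e = fid_eps B A e.
Proof.
move=> pA pB e0; rewrite /fid_eps.
by rewrite (geomeanmxC (pdmxDscalar pA e0) (pdmxDscalar pB e0)).
Qed.

Lemma geom_fidC n (A B : 'M[C]_n) : psdmx A -> psdmx B ->
  geom_fid A B = geom_fid B A.
Proof.
move=> pA pB; apply/eqP; rewrite eq_le; apply/andP; split.
  apply: geom_fid_ge => e e0; rewrite fid_epsC //; exact: geom_fid_le.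
apply: geom_fid_ge => e e0; rewrite fid_epsC //; exact: geom_fid_le.
Qed.

Lemma geomeanmx_id n (A : 'M[C]_n) : pdmx A -> geomeanmx A A = A.
Proof.
by move=> pA; have [pA' uA] := pA; apply: geomeanmx_uniq;
  rewrite ?mulmxV ?mul1mx.
Qed.

Lemma Re_mxtraceD_scalar n (A : 'M[C]_n) (e : R) :
  complex.Re (\tr (A + e%:C%:M)) = complex.Re (\tr A) + e * n%:R.
Proof.
by rewrite mxtraceD ReD mxtrace_scalar -rmorphMn /= mulr_natr.
Qed.

Lemma geom_fid_id n (A : 'M[C]_n) : psdmx A ->
  geom_fid A A = complex.Re (\tr A).
Proof.
move=> pA.
have fE e : 0 < e -> fid_eps A A e = complex.Re (\tr A) + e * n%:R.
  move=> e0; rewrite /fid_eps geomeanmx_id; last exact: pdmxDscalar.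
  exact: Re_mxtraceD_scalar.
apply: geom_fid_eq => // [e e0|d d0].
  by rewrite fE // lerDl mulr_ge0 // ltW.
(* The excess is e n, which is then at most d; the successor keeps the divisor positive when n =
   0. *)
exists (d / n.+1%:R); first by rewrite divr_gt0.
rewrite fE ?divr_gt0 // lerD2l -mulrA ler_piMr ?(ltW d0) //.
by rewrite mulrC ler_pdivrMr ?mul1r ?ler_nat.
Qed.

(* Testing feasibility on [(v, -v)] gives [2 X <= A + B]. *)
Lemma gfeas_le_mean n (A B X : 'M[C]_n) : psdmx A -> psdmx B -> gfeas A B X ->
  psdmx (A + B - (X + X)).
Proof.
move=> pA pB [hX h]; apply: psdmxI => [|v].
  by rewrite adjmxB !adjmxD hX !psdmx_herm.
have := h v (- v); rewrite !(qformNl, qformNr) opprK qformB !qformD.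
by move=> h'; apply: le_trans h' _; rewrite le_eqVlt; apply/orP; left;
  apply/eqP; ring.
Qed.

End Fid.

(** * Tensor products and super-multiplicativity *)

Section Tens.
Variable R : realType.
Local Notation C := R[i].
Local Open Scope complex_scope.

Lemma tensmxDl m n p q (A A' : 'M[C]_(m, n)) (B : 'M[C]_(p, q)) :
  (A + A') *t B = A *t B + A' *t B.
Proof. by apply/matrixP => i j; rewrite !mxE mulrDl. Qed.

Lemma tensmxDr m n p q (A : 'M[C]_(m, n)) (B B' : 'M[C]_(p, q)) :
  A *t (B + B') = A *t B + A *t B'.
Proof. by apply/matrixP => i j; rewrite !mxE mulrDr. Qed.

Lemma tensmxNr m n p q (A : 'M[C]_(m, n)) (B : 'M[C]_(p, q)) :
  A *t (- B) = - (A *t B).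
Proof. by apply/matrixP => i j; rewrite !mxE mulrN. Qed.

Lemma tensmxNl m n p q (A : 'M[C]_(m, n)) (B : 'M[C]_(p, q)) :
  (- A) *t B = - (A *t B).
Proof. by apply/matrixP => i j; rewrite !mxE mulNr. Qed.

Lemma tensmxZl m n p q c (A : 'M[C]_(m, n)) (B : 'M[C]_(p, q)) :
  (c *: A) *t B = c *: (A *t B).
Proof. by apply/matrixP => i j; rewrite !mxE mulrA. Qed.

Lemma tensmxZr m n p q c (A : 'M[C]_(m, n)) (B : 'M[C]_(p, q)) :
  A *t (c *: B) = c *: (A *t B).
Proof. by apply/matrixP => i j; rewrite !mxE mulrCA. Qed.

Lemma tensmx_suml m n p q (I : Type) (s : seq I) (P : pred I)
    (F : I -> 'M[C]_(m, n)) (B : 'M[C]_(p, q)) :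
  (\sum_(i <- s | P i) F i) *t B = \sum_(i <- s | P i) F i *t B.
Proof.
apply: (big_morph (fun X : 'M[C]_(m, n) => X *t B)) => [X Y|].
  exact: tensmxDl.
exact: tens0mx.
Qed.

Lemma tensmx11 m n : (1%:M : 'M[C]_m) *t (1%:M : 'M[C]_n) = 1%:M.
Proof.
apply/matrixP => u v.
case: (mxtens_indexP u) => a i; case: (mxtens_indexP v) => b j.
rewrite tensmxE !mxE (can_eq (@mxtens_indexK _ _)) xpair_eqE.
by rewrite -natrM mulnb.
Qed.

Lemma mxtrace_tens m n (A : 'M[C]_m) (B : 'M[C]_n) :
  \tr (A *t B) = \tr A * \tr B.
Proof. by rewrite /mxtrace mulr_sum; apply: eq_bigr => i _; rewrite mxE. Qed.

Lemma tensmx_inv m n (A : 'M[C]_m) (B : 'M[C]_n) :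
  A \in unitmx -> B \in unitmx ->
  A *t B \in unitmx /\ invmx (A *t B) = invmx A *t invmx B.
Proof.
move=> uA uB.
have e : (A *t B) *m (invmx A *t invmx B) = 1%:M.
  by rewrite tensmx_mul !mulmxV // tensmx11.
have [u _] := mulmx1_unit e; split=> //.
by apply: (can_inj (mulKmx u)); rewrite e mulmxV.
Qed.

Lemma pdmx_tens m n (A : 'M[C]_m) (B : 'M[C]_n) :
  pdmx A -> pdmx B -> pdmx (A *t B).
Proof.
move=> [pA uA] [pB uB]; split; first exact: psdmx_tens.
by have [] := tensmx_inv uA uB.
Qed.

(** The tensor product of two Riccati solutions solves the tensored Riccati equation, whose positive
    solution is unique. *)
Lemma geomeanmx_tens m n (A B : 'M[C]_m) (A' B' : 'M[C]_n) :
  pdmx A -> psdmx B -> pdmx A' -> psdmx B' ->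
  geomeanmx (A *t A') (B *t B') = geomeanmx A B *t geomeanmx A' B'.
Proof.
move=> pA pB pA' pB'; apply: geomeanmx_uniq.
- exact: pdmx_tens.
- exact: psdmx_tens.
- by apply: psdmx_tens; apply: geomeanmx_psd.
have [[_ uA] [_ uA']] := (pA, pA').
have [_ ->] := tensmx_inv uA uA'.
rewrite !tensmx_mul.
by rewrite (geomeanmx_riccati pA pB) (geomeanmx_riccati pA' pB').
Qed.

(* If [X] and [Y] are states and [0 < d <= 1], the difference is
   [d (1 - X) (x) 1 + d 1 (x) (1 - Y)], up to a nonnegative multiple of [1]. *)
Lemma psdmx_tens_shift m n (X : 'M[C]_m) (Y : 'M[C]_n) (d e : R) :
  is_state X -> is_state Y -> 0 < d -> d + d + d * d <= e ->
  psdmx (X *t Y + e%:C%:M - (X + d%:C%:M) *t (Y + d%:C%:M)).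
Proof.
move=> [pX tX] [pY tY] d0 dle.
have lX := psdmx_le_trace pX; have lY := psdmx_le_trace pY.
rewrite tX in lX; rewrite tY in lY.
have -> : X *t Y + e%:C%:M - (X + d%:C%:M) *t (Y + d%:C%:M) =
    d%:C *: ((1%:M - X) *t 1%:M) + d%:C *: (1%:M *t (1%:M - Y))
    + (e - (d + d + d * d))%:C%:M.
  rewrite -(scalemx1 m d%:C) -(scalemx1 n d%:C) -(scalemx1 _ e%:C).
  rewrite -(scalemx1 _ (_ - _)%:C).
  rewrite !(tensmxDl, tensmxDr, tensmxNl, tensmxNr, tensmxZl, tensmxZr).
  rewrite tensmx11 rmorphB !rmorphD rmorphM /=.
  move: (X *t Y) (X *t 1%:M) (1%:M *t Y) (1%:M : 'M_(m * n)) => XY X1 Y1 I.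
  move: d%:C e%:C => dC eC; apply/matrixP => i j; rewrite !mxE.
  by move: (XY i j) (X1 i j) (Y1 i j) (I i j) => ? ? ? ?; ring.
apply: psdmxD; last by apply: psdmx_scalar; rewrite ler0c subr_ge0.
have dC0 : 0 <= d%:C by rewrite ler0c ltW.
apply: psdmxD; apply: (psdmxZ dC0).
  exact: psdmx_tens lX (psdmx1 R n).
exact: psdmx_tens (psdmx1 R m) lY.
Qed.

(** Both factors are bounded by their values at a perturbation d so small that (A + d) (x) (A' + d)
    <= A (x) A' + e, and likewise for B; multiplicativity and monotonicity of the mean conclude. *)
Lemma geom_fid_tens m n (A B : 'M[C]_m) (A' B' : 'M[C]_n) :
  is_state A -> is_state B -> is_state A' -> is_state B' ->
  geom_fid A B * geom_fid A' B' <= geom_fid (A *t A') (B *t B').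
Proof.
move=> sA sB sA' sB'.
have [[pA _] [pB _]] := (sA, sB); have [[pA' _] [pB' _]] := (sA', sB').
apply: geom_fid_ge => e e0.
(* As d <= 1, one has d + d + d^2 <= 3 d <= e. *)
pose d : R := Num.min 1 (e / 3%:R).
have d0 : 0 < d by rewrite lt_min ltr01 divr_gt0.
have dle : d + d + d * d <= e.
  have d1 : d <= 1 by rewrite ge_min lexx.
  have : d <= e / 3%:R by rewrite ge_min lexx orbT.
  have : d * d <= d by rewrite ler_piMl // ltW.
  lra.
have q1 := pdmxDscalar pA d0; have q2 := pdmxDscalar pB d0.
have q3 := pdmxDscalar pA' d0; have q4 := pdmxDscalar pB' d0.
have [q2' _] := q2; have [q4' _] := q4.
apply: (@le_trans _ _ (fid_eps A B d * fid_eps A' B' d)).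
  apply: ler_pM; [exact: geom_fid_ge0|exact: geom_fid_ge0| |];
    exact: geom_fid_le.
rewrite /fid_eps -ReM_ge0; [|exact/mxtrace_psd/geomeanmx_psd..].
rewrite -mxtrace_tens -(geomeanmx_tens q1 q2' q3 q4').
have t1 := psdmx_tens pA pA'; have t2 := psdmx_tens pB pB'.
have [t2' _] := pdmxDscalar t2 e0.
have h := geomeanmx_mono (pdmx_tens q1 q3) (psdmx_tens q2' q4')
  (pdmxDscalar t1 e0) t2' (psdmx_tens_shift sA sA' d0 dle)
  (psdmx_tens_shift sB sB' d0 dle).
exact: ler_Re h.
Qed.

Lemma state_tens m n (A : 'M[C]_m) (B : 'M[C]_n) :
  is_state A -> is_state B -> is_state (A *t B).
Proof.
move=> [pA tA] [pB tB]; split; first exact: psdmx_tens.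
by rewrite mxtrace_tens tA tB mulr1.
Qed.

Lemma state_ntens n (A : 'M[C]_n) k : is_state A -> is_state (ntensmx A k.+1).
Proof.
by move=> sA; elim: k => // k IH; rewrite ntensmxSS; apply: state_tens.
Qed.

Lemma geom_fid_ntens n (A B : 'M[C]_n) k : is_state A -> is_state B ->
  geom_fid A B ^+ k.+1 <= geom_fid (ntensmx A k.+1) (ntensmx B k.+1).
Proof.
move=> sA sB; elim: k => [|k IH]; first by rewrite expr1 lexx.
rewrite !ntensmxSS exprS.
have h := geom_fid_tens sA sB (state_ntens k sA) (state_ntens k sB).
apply: le_trans h; apply: ler_wpM2l IH.
by apply: geom_fid_ge0; [case: sA | case: sB].
Qed.

End Tens.

(** * Faithfulness of the pairwise fidelity *)

Section Faithful.
Variable R : realType.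
Local Notation C := R[i].
Local Open Scope complex_scope.

Lemma ReB (x y : C) : complex.Re (x - y) = complex.Re x - complex.Re y.
Proof. by case: x y => [a b] [c d]. Qed.

Lemma Re_state n (A : 'M[C]_n) e : is_state A ->
  complex.Re (\tr (A + e%:C%:M)) = 1 + e * n%:R.
Proof. by case=> _ t; rewrite Re_mxtraceD_scalar t. Qed.

Lemma Re_mxtrace_mean n (X Y Z : 'M[C]_n) :
  complex.Re (\tr (X + Y - (Z + Z))) = complex.Re (\tr X)
    + complex.Re (\tr Y) - (complex.Re (\tr Z) + complex.Re (\tr Z)).
Proof. by rewrite linearB /= !mxtraceD ReB !ReD. Qed.

(** The arithmetic-geometric mean inequality under the trace: each perturbed state has trace 1 + e
    n. *)
Lemma fid_eps_le n (A B : 'M[C]_n) e : is_state A -> is_state B -> 0 < e ->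
  fid_eps A B e <= 1 + e * n%:R.
Proof.
move=> sA sB e0; have [[pA _] [pB _]] := (sA, sB).
have q1 := pdmxDscalar pA e0; have [q2 _] := pdmxDscalar pB e0.
have [q1' _] := q1.
have := ler_Re (mxtrace_psd (gfeas_le_mean q1' q2 (geomeanmx_gfeas q1 q2))).
rewrite Re_mxtrace_mean !Re_state // -/(fid_eps A B e); lra.
Qed.

Lemma geom_fid_le1 n (A B : 'M[C]_n) : is_state A -> is_state B ->
  geom_fid A B <= 1.
Proof.
move=> sA sB; have [[pA _] [pB _]] := (sA, sB).
apply/ler_addgt0Pr => d d0; pose e := d / n.+1%:R.
have e0 : 0 < e by rewrite divr_gt0.
apply: le_trans (geom_fid_le pA pB e0) _; apply: le_trans (fid_eps_le sA sB e0)
  _.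
rewrite lerD2l /e -mulrA ler_piMr ?(ltW d0) //.
by rewrite mulrC ler_pdivrMr ?mul1r ?ler_nat.
Qed.

Definition sqnorm m (v : 'cV[C]_m) : R := complex.Re ((adjmx v *m v) 0 0).

Lemma sqnorm_ge0 m (v : 'cV[C]_m) : 0 <= sqnorm v.
Proof. exact: (@ler_Re _ 0 _ (norm_col_ge0 v)). Qed.

Lemma sqnorm_eq0 m (v : 'cV[C]_m) : sqnorm v = 0 -> v = 0.
Proof.
move=> h; apply: norm_col_eq0; move: (norm_col_ge0 v) h; rewrite /sqnorm.
by case: (_ 0 0) => [a b] /ger0_Im /= -> ->.
Qed.

Lemma Re_qform_le n (P : 'M[C]_n) v : psdmx P ->
  complex.Re (qform P v v) <= complex.Re (\tr P) * sqnorm v.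
Proof.
move=> pP; rewrite -ReM_ge0 ?mxtrace_psd ?norm_col_ge0 //.
have := ler_Re (psdmx_ge0 v (psdmx_le_trace pP)); rewrite qformB ReB subr_ge0.
by rewrite {2}/qform mul_mx_scalar -scalemxAl mxE.
Qed.

(* Testing feasibility of [X] on [(u + w, u - w)]. *)
Lemma gfeas_hadamard n (A B X : 'M[C]_n) u w : gfeas A B X ->
  0 <= qform (A + B + (X + X)) u u + qform (A + B - (X + X)) w w
       + qform (A - B) u w + qform (A - B) w u.
Proof.
move=> [hX h]; have := h (u + w) (u - w).
rewrite !(qformDl, qformDr, qformNl, qformNr) !(qformB, qformD).
move: (qform A) (qform B) (qform X) => a b x h'; apply: le_trans h' _.
by rewrite le_eqVlt; apply/orP; left; apply/eqP; ring.
Qed.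

(** Let D = A - B. The rotated block form at (u, - s D u) bounds 2 s |D u|^2 by the form of P at u
    plus s^2 times the form of Q at D u. The trace of P is bounded, and that of Q is at most 2 e n
    because the fidelity is 1. With e = s^-2 the bound does not depend on s, so D u = 0. *)
Lemma geom_fid_eq1 n (A B : 'M[C]_n) : is_state A -> is_state B ->
  geom_fid A B = 1 -> A = B.
Proof.
move=> sA sB F1; have [[pA _] [pB _]] := (sA, sB).
pose D := A - B.
have hD : adjmx D = D by rewrite /D adjmxB !psdmx_herm.
suff D0 (u : 'cV_n) : D *m u = 0.
  apply/eqP; rewrite -subr_eq0; apply/eqP/matrixP => i j.
  by have /colP/(_ i) := D0 (delta_mx j 0); rewrite -colE !mxE.
apply: sqnorm_eq0; set a := sqnorm (D *m u); set b := sqnorm u.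
have a0 : 0 <= a := sqnorm_ge0 _; have b0 : 0 <= b := sqnorm_ge0 _.
have key s : 1 <= s -> 2 * s * a <= (4 + 4 * n%:R) * b + 2 * n%:R * a.
  move=> s1; have s0 : 0 < s by apply: lt_le_trans s1.
  (* This e makes s^2 times the trace bound 2 e n of Q equal to 2 n. *)
  pose e := (s * s)^-1; have e0 : 0 < e by rewrite invr_gt0 mulr_gt0.
  have e1 : e <= 1 by rewrite invf_le1 ?mulr_gt0 // mulr_ege1.
  have q1 := pdmxDscalar pA e0; have [q2 _] := pdmxDscalar pB e0.
  have [q1' _] := q1; have fG := geomeanmx_gfeas q1 q2.
  have f1 : 1 <= fid_eps A B e by rewrite -F1; exact: geom_fid_le.
  have f2 := fid_eps_le sA sB e0.
  have tA := Re_state e sA; have tB := Re_state e sB.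
  have pG := geomeanmx_psd q1 q2.
  rewrite /fid_eps in f1 f2.
  move: (geomeanmx _ _) fG f1 f2 pG => G fG f1 f2 pG.
  have ABD : A + e%:C%:M - (B + e%:C%:M) = D.
    by rewrite opprD addrACA subrr addr0.
  have := gfeas_hadamard u (- (s%:C *: (D *m u))) fG; rewrite ABD.
  set P := _ + (G + G); set Q := _ - (G + G).
  rewrite !(qformNl, qformNr, qformZl, qformZr) realc_conj mulrN opprK.
  have -> : qform D u (D *m u) = (adjmx (D *m u) *m (D *m u)) 0 0.
    by rewrite /qform adjmxM hD !mulmxA.
  have -> : qform D (D *m u) u = (adjmx (D *m u) *m (D *m u)) 0 0.
    by rewrite /qform adjmxM hD !mulmxA.
  move=> /ler_Re; rewrite /= !(ReB, ReD) !ReZ -/(sqnorm _) -/a => h.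
  have pQ : psdmx Q by exact: gfeas_le_mean q1' q2 fG.
  have pP : psdmx P.
    by apply: psdmxD (psdmxD pG pG); exact: psdmxD q1' q2.
  have := Re_qform_le u pP; have := Re_qform_le (D *m u) pQ.
  have -> : complex.Re (\tr P) = complex.Re (\tr (A + e%:C%:M))
      + complex.Re (\tr (B + e%:C%:M))
      + (complex.Re (\tr G) + complex.Re (\tr G)).
    by rewrite /P !mxtraceD !ReD.
  rewrite Re_mxtrace_mean tA tB -/a -/b.
  move: (complex.Re (\tr G)) (complex.Re (qform P u u)) f1 f2 h => g qP.
  move: (complex.Re (qform Q (D *m u) (D *m u))) => qQ f1 f2 h hQ hP.
  have n0 : 0 <= n%:R :> R by [].
  have hP' : qP <= (4 + 4 * n%:R) * b.
    apply: le_trans hP _; apply: ler_wpM2r => //.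
    have : e * n%:R <= n%:R by rewrite ler_piMl.
    lra.
  have hQ' : qQ <= 2 * (e * n%:R) * a.
    apply: le_trans hQ _; apply: ler_wpM2r => //; lra.
  have : s * (s * qQ) <= s * (s * (2 * (e * n%:R) * a)) by rewrite !ler_pM2l.
  have -> : s * (s * (2 * (e * n%:R) * a)) = 2 * n%:R * a.
    by rewrite /e; field; rewrite gt_eqF.
  lra.
apply/eqP; rewrite eq_le a0 andbT leNgt; apply/negP => a_gt0.
pose c := (4 + 4 * n%:R) * b + 2 * n%:R * a.
have c0 : 0 <= c.
  have n0 : 0 <= n%:R :> R by [].
  by rewrite /c addr_ge0 ?mulr_ge0 ?addr_ge0 ?mulr_ge0.
(* At this s the left side of [key] is 2 a + 2 c, which exceeds c. *)
have := key (1 + c / a); rewrite -/c lerDl divr_ge0 // => /(_ isT).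
have ca : c / a * a = c by rewrite divfK ?gt_eqF.
move: (c / a) ca => t ca; have -> : 2 * (1 + t) * a = 2 * a + 2 * (t * a) by
  ring.
rewrite ca; move: c c0 {key ca} => c c0; lra.
Qed.

End Faithful.

(** * Data processing under channels *)

Section Channel.
Variable R : realType.
Local Notation C := R[i].
Local Open Scope complex_scope.

Lemma qform_tens k m (D : 'M[C]_k) (M : 'M[C]_m) (s t : 'cV_k) (x y : 'cV_m) :
  qform (D *t M) (s *t x : 'cV_(k * m)) (t *t y : 'cV_(k * m)) =
  qform D s t * qform M x y.
Proof.
have e : adjmx (s *t x) *m (D *t M) *m (t *t y) =
    (adjmx s *m D *m t) *t (adjmx x *m M *m y).
  by rewrite adjmx_tens !tensmx_mul.
rewrite /qform; move: (adjmx s *m D *m t) (adjmx x *m M *m y) e => X Y e.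
(* The tensor product of two 1 by 1 matrices has size 1 * 1, which computes to 1; only the names of
   its single index have to be identified. *)
transitivity ((X *t Y : 'M_1) 0 0); first by rewrite -[X *t Y]e.
rewrite -(tensmxE X Y); congr (fun_of_matrix (X *t Y : 'M_1) _ _);
  exact: val_inj.
Qed.

Lemma qform_delta k (a b c d : 'I_k) :
  qform (delta_mx a b : 'M[C]_k) (delta_mx c 0) (delta_mx d 0) =
  (c == a)%:R * (d == b)%:R.
Proof.
rewrite /qform adjmx_delta; case: (eqVneq c a) => [->|ca].
  rewrite mul_delta_mx; case: (eqVneq d b) => [->|db].
    by rewrite mul_delta_mx mxE !eqxx mulr1.
  by rewrite mul_delta_mx_0 ?mxE ?mulr0 // eq_sym.
by rewrite mul_delta_mx_0 // mul0mx mxE mul0r.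
Qed.

(** The block matrix [[A, X], [X, B]] is written as an element of M_2 (x) M_n, so that the
    ampliation of a map acts on it block by block. *)
Definition blockmx2 n (A B X : 'M[C]_n) : 'M[C]_(2 * n) :=
  delta_mx 0 0 *t A + delta_mx 0 1 *t X + delta_mx 1 0 *t X
  + delta_mx 1 1 *t B.

Lemma blockmx2_gfeas n (A B X : 'M[C]_n) : adjmx X = X ->
  psdmx (blockmx2 A B X) -> gfeas A B X.
Proof.
move=> hX pM; split=> // u v.
pose w : 'cV[C]_(2 * n) :=
  (delta_mx 0 0 : 'cV_2) *t u + (delta_mx 1 0 : 'cV_2) *t v.
have := psdmx_ge0 w pM; rewrite /w /blockmx2.
rewrite !(qformDl, qformDr) !qformD !qform_tens !qform_delta /=.
by rewrite !(mul0r, mulr0, add0r, addr0, mul1r) !addrA.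
Qed.

Lemma ampliationD k m n (N : {linear 'M[C]_n -> 'M[C]_m})
    (X Y : 'M[C]_(k * n)) :
  ampliation N (X + Y) = ampliation N X + ampliation N Y.
Proof.
rewrite /ampliation -big_split; apply: eq_bigr => a _ /=.
rewrite -big_split; apply: eq_bigr => b _ /=.
rewrite -tensmxDr -linearD; congr (_ *t N _).
by apply/matrixP => i j; rewrite !mxE.
Qed.

Lemma ampliation_blockmx2 m n (N : {linear 'M[C]_n -> 'M[C]_m})
    (A B X : 'M[C]_n) :
  ampliation N (blockmx2 A B X) = blockmx2 (N A) (N B) (N X).
Proof. by rewrite /blockmx2 !ampliationD !ampliation_tens. Qed.

(** With A = P^* P, the block matrix is the Gram matrix of the block row [P, P A^-1 G], padded by a
    zero row. *)
Lemma blockmx2_riccati n (A B G : 'M[C]_n) : pdmx A -> adjmx G = G ->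
  G *m invmx A *m G = B -> psdmx (blockmx2 A B G).
Proof.
move=> [pA uA] hG e; have [P AE] := psdmxP pA.
have hA := psdmx_herm pA.
have uP : P \in unitmx by move: uA; rewrite AE unitmx_mul => /andP[].
pose M : 'M[C]_(2 * n) := delta_mx 0 0 *t P + delta_mx 0 1 *t (P *m invmx A *m
  G).
have -> : blockmx2 A B G = adjmx M *m M; last exact: psdmx_gram.
rewrite /M adjmxD !adjmx_tens !adjmx_delta mulmxDl !mulmxDr !tensmx_mul.
rewrite !mul_delta_mx /blockmx2 !addrA; congr (_ *t _ + _ *t _ + _ *t _ + _ *t
  _).
- by [].
- by rewrite !mulmxA -AE mulmxV // mul1mx.
- by rewrite !adjmxM adjmx_inv hA hG -!mulmxA -AE mulVmx // mulmx1.
- rewrite !adjmxM adjmx_inv hA hG -e !mulmxA.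
  by rewrite -(mulmxA _ _ P) -AE -(mulmxA _ _ A) mulVmx // mulmx1.
Qed.

Section CP.
Variables (m n : nat) (N : {linear 'M[C]_n -> 'M[C]_m}).
Hypothesis cpN : completely_positive N.

(** Complete positivity at k = 1, after stripping the tensor factor of size 1. *)
Lemma cp_psd A : psdmx A -> psdmx (N A).
Proof.
move=> pA; pose D : 'M[C]_1 := 1%:M.
have /cpN : psdmx (D *t A) by apply: psdmx_tens pA; exact: psdmx1.
rewrite ampliation_tens => pDN.
have hN : adjmx (N A) = N A.
  have := psdmx_herm pDN; rewrite adjmx_tens /D adjmx1 => /matrixP h.
  apply/matrixP => i j.
  have := h (mxtens_index (0, i)) (mxtens_index (0, j)).
  by rewrite !tensmxE mxE eqxx !mul1r.
apply: psdmxI => // v.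
have := psdmx_ge0 ((1%:M : 'cV_1) *t v : 'cV_(1 * m)) pDN.
rewrite qform_tens {1}/qform adjmx1 !mulmx1 /D.
by rewrite mxE eqxx mul1r.
Qed.

(** Complete positivity at k = 2, applied to the block matrix. *)
Lemma cp_gfeas A B G : pdmx A -> psdmx G -> G *m invmx A *m G = B ->
  gfeas (N A) (N B) (N G).
Proof.
move=> pA pG e; apply: blockmx2_gfeas.
  exact/psdmx_herm/cp_psd.
rewrite -ampliation_blockmx2; apply: cpN.
by apply: blockmx2_riccati => //; apply: psdmx_herm.
Qed.
End CP.

(** The image under N of the mean of A + e and B + e has the same trace and is feasible for N(A) +
    e' and N(B) + e', hence lies below their mean. *)
Lemma geom_fid_channel m n (N : {linear 'M[C]_n -> 'M[C]_m}) A B :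
  is_channel N -> psdmx A -> psdmx B ->
  geom_fid A B <= geom_fid (N A) (N B).
Proof.
move=> [cpN trN] pA pB.
have pNA := cp_psd cpN pA; have pNB := cp_psd cpN pB.
apply: geom_fid_ge => e' e'0.
(* Since Tr N(1) = n, one has e N(1) <= e n <= e' for e = e' / (n + 1). *)
pose c : R := n.+1%:R; have c0 : 0 < c by rewrite ltr0n.
pose e := e' / c; have e0 : 0 < e by rewrite divr_gt0.
have q1 := pdmxDscalar pA e0; have [q2 _] := pdmxDscalar pB e0.
apply: le_trans (geom_fid_le pA pB e0) _.
have pI := cp_psd cpN (psdmx1 R n).
have shift X : psdmx (N X + e'%:C%:M - N (X + e%:C%:M)).
  have -> : N X + e'%:C%:M - N (X + e%:C%:M) =
      e%:C *: ((\tr (N 1%:M))%:M - N 1%:M) + e%:C%:M.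
    rewrite linearD -(scalemx1 n e%:C) linearZ /= opprD addrACA subrr add0r.
    rewrite scalerBr trN mxtrace1 scale_scalar_mx addrAC -raddfD /=.
    congr (_%:M - _); rewrite -[X in _ = _ + X]mulr1 -mulrDr natr1.
    by rewrite -(rmorph_nat (real_complex R)) -rmorphM /= /e divfK // gt_eqF.
  have e0' : 0 <= e%:C by rewrite ler0c ltW.
  apply: psdmxD (psdmx_scalar _ e0').
  exact: psdmxZ e0' (psdmx_le_trace pI).
have q3 := pdmxDscalar pNA e'0; have [q4 _] := pdmxDscalar pNB e'0.
have fN := cp_gfeas cpN q1 (geomeanmx_psd q1 q2) (geomeanmx_riccati q1 q2).
have := mxtrace_psd (gfeas_le q3 q4 (gfeas_mono (shift A) (shift B) fN)).
by rewrite linearB /= trN subr_ge0 => /ler_Re.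
Qed.

End Channel.

(** * Scaling, block diagonal matrices and the direct-sum property *)

Section DirectSum.
Variable R : realType.
Local Notation C := R[i].
Local Open Scope complex_scope.

(** For p > 0 the change of variable from e to p e rescales the infimum; for p = 0 both arguments
    vanish. *)
Lemma geom_fidZ n (A B : 'M[C]_n) (p : R) : psdmx A -> psdmx B -> 0 <= p ->
  geom_fid (p%:C *: A) (p%:C *: B) = p * geom_fid A B.
Proof.
move=> pA pB; rewrite le_eqVlt => /predU1P[<-|p0].
  by rewrite mul0r !scale0r geom_fid_id ?mxtrace0 //; exact: psdmx0.
have p0' : 0 < p%:C by rewrite ltcR.
have pA' := psdmxZ (ltW p0') pA; have pB' := psdmxZ (ltW p0') pB.
have fE e : 0 < e -> fid_eps (p%:C *: A) (p%:C *: B) (p * e) = p * fid_eps A B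
  e.
  move=> e0; rewrite /fid_eps rmorphM /= -!scale_scalar_mx -!scalerDr.
  rewrite (geomeanmxZ p0' (pdmxDscalar pA e0) (proj1 (pdmxDscalar pB e0))).
  by rewrite linearZ ReZ.
apply: geom_fid_eq => // [e e0|d d0].
  have ep : 0 < e / p by rewrite divr_gt0.
  have := fE _ ep; rewrite mulrC divfK ?gt_eqF // => ->.
  by rewrite ler_pM2l //; exact: geom_fid_le.
have dp : 0 < d / p by rewrite divr_gt0.
have [e e0 he] := geom_fid_adherent pA pB dp.
exists (p * e); first by rewrite mulr_gt0.
have := he e e0 (lexx e); rewrite fE // -(ltr_pM2l p0) mulrDr => /ltW.
by rewrite [X in _ <= _ + X -> _]mulrC divfK ?gt_eqF.
Qed.

(** The least of finitely many thresholds from [geom_fid_adherent] works for every x at once; the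
    induction runs over the enumeration of X. *)
Lemma geom_fid_adherent_all (X : finType) n (A B : X -> 'M[C]_n) d :
  (forall x, psdmx (A x)) -> (forall x, psdmx (B x)) -> 0 < d ->
  exists2 e, 0 < e & forall x, fid_eps (A x) (B x) e <= geom_fid (A x) (B x) +
    d.
Proof.
move=> pA pB d0.
suff [e e0 he] : exists2 e, 0 < e & forall x, x \in enum X ->
    forall e', 0 < e' -> e' <= e ->
      fid_eps (A x) (B x) e' < geom_fid (A x) (B x) + d.
  by exists e => // x; apply/ltW/he => //; rewrite mem_enum.
elim: (enum X) => [|x s [e e0 he]]; first by exists 1.
have [e1 e10 he1] := geom_fid_adherent (pA x) (pB x) d0.
exists (Num.min e e1); first by rewrite lt_min e0.
move=> y; rewrite inE => /predU1P[->|ys] e' e'0; rewrite le_min => /andP[l1 l2].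
  exact: he1.
exact: he.
Qed.

Section Blocks.
Variables (X : finType) (ket : X -> 'cV[C]_#|X|) (n : nat).
Hypothesis ketP : orthonormal_basis ket.

Let proj x := ket x *m adjmx (ket x).

Definition blockdiag (F : X -> 'M[C]_n) : 'M[C]_(#|X| * n) :=
  \sum_x proj x *t F x.

Lemma ket_dot x y : adjmx (ket x) *m ket y = (x == y)%:R%:M.
Proof. by apply/matrixP => i j; rewrite !ord1 ketP !mxE eqxx mulr1n. Qed.

Lemma projM x y : proj x *m proj y = (x == y)%:R *: proj x.
Proof.
rewrite /proj mulmxA -(mulmxA (ket x)) ket_dot mul_mx_scalar -scalemxAl.
by case: eqP => [->//|_]; rewrite !scale0r.
Qed.

Lemma proj_psd x : psdmx (proj x).
Proof. by rewrite /proj -{1}[ket x]adjmxK; exact: psdmx_gram. Qed.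

Lemma mxtrace_proj x : \tr (proj x) = 1.
Proof. by rewrite mxtrace_mulC ket_dot eqxx mxtrace_scalar. Qed.

(** The kets are the columns of a square matrix U with U^* U = 1, so U U^* = 1 as well, and U U^* is
    the sum of the projectors. *)
Lemma sum_proj : \sum_x proj x = 1%:M.
Proof.
pose U : 'M[C]_#|X| := \matrix_(i, j) ket (enum_val j) i 0.
have UU : adjmx U *m U = 1%:M.
  apply/matrixP => i j; rewrite !mxE -(inj_eq enum_val_inj) -ketP mxE.
  by apply: eq_bigr => k _; rewrite !mxE.
rewrite -(mulmx1C UU); apply/matrixP => i j; rewrite summxE mxE.
rewrite (reindex_onto (@enum_val X X) (@enum_rank X)) /=; last first.
  by move=> x _; rewrite enum_rankK.
apply: eq_big => [k|k _]; first by rewrite enum_valK eqxx.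
by rewrite !mxE big_ord1 !mxE.
Qed.

Lemma blockdiagM F G :
  blockdiag F *m blockdiag G = blockdiag (fun x => F x *m G x).
Proof.
rewrite /blockdiag mulmx_suml; apply: eq_bigr => x _.
rewrite mulmx_sumr (bigD1 x) //= tensmx_mul projM eqxx scale1r.
rewrite big1 ?addr0 // => y yx.
by rewrite tensmx_mul projM eq_sym (negPf yx) scale0r tens0mx.
Qed.

Lemma blockdiagD F G :
  blockdiag F + blockdiag G = blockdiag (fun x => F x + G x).
Proof.
by rewrite /blockdiag -big_split; apply: eq_bigr => x _; rewrite tensmxDr.
Qed.

Lemma blockdiag_scalar (c : C) : blockdiag (fun=> c%:M) = c%:M.
Proof.
rewrite /blockdiag -tensmx_suml sum_proj -[in LHS](scalemx1 n c) tensmxZr.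
by rewrite tensmx11 scalemx1.
Qed.

Lemma blockdiag_psd F : (forall x, psdmx (F x)) -> psdmx (blockdiag F).
Proof.
move=> pF; apply: psdmx_sum => x _; exact: psdmx_tens (proj_psd x) (pF x).
Qed.

Lemma mxtrace_blockdiag F : \tr (blockdiag F) = \sum_x \tr (F x).
Proof.
rewrite /blockdiag raddf_sum; apply: eq_bigr => x _ /=.
by rewrite mxtrace_tens mxtrace_proj mul1r.
Qed.

Lemma blockdiag_inv F : (forall x, F x \in unitmx) ->
  blockdiag F \in unitmx /\ invmx (blockdiag F) = blockdiag (fun x => invmx (F
    x)).
Proof.
move=> uF; have e : blockdiag F *m blockdiag (fun x => invmx (F x)) = 1%:M.
  rewrite blockdiagM -(blockdiag_scalar 1); apply: eq_bigr => x _.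
  by rewrite mulmxV.
have [u _] := mulmx1_unit e; split=> //.
by apply: (can_inj (mulKmx u)); rewrite e mulmxV.
Qed.

(** The Riccati equation holds block by block, and its positive solution is unique. *)
Lemma geomeanmx_blockdiag F G : (forall x, pdmx (F x)) ->
  (forall x, psdmx (G x)) ->
  geomeanmx (blockdiag F) (blockdiag G) = blockdiag (fun x => geomeanmx (F x) (G
    x)).
Proof.
move=> pF pG.
have [u iE] : _ /\ _ := blockdiag_inv (fun x => proj2 (pF x)).
apply: geomeanmx_uniq.
- by split=> //; apply: blockdiag_psd => x; case: (pF x).
- exact: blockdiag_psd.
- by apply: blockdiag_psd => x; apply: geomeanmx_psd.
rewrite iE !blockdiagM; apply: eq_bigr => x _.
by rewrite (geomeanmx_riccati (pF x) (pG x)).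
Qed.

Lemma fid_eps_blockdiag F G e : (forall x, psdmx (F x)) ->
  (forall x, psdmx (G x)) -> 0 < e ->
  fid_eps (blockdiag F) (blockdiag G) e = \sum_x fid_eps (F x) (G x) e.
Proof.
move=> pF pG e0; rewrite /fid_eps -(blockdiag_scalar e%:C) !blockdiagD.
rewrite geomeanmx_blockdiag => [|x|x]; last 2 first.
- exact: pdmxDscalar.
- by case: (pdmxDscalar (pG x) e0).
by rewrite mxtrace_blockdiag Re_sum.
Qed.

(** The infimum of the sum is the sum of the infima, because one e brings every block within d /
    (#|X| + 1) of its infimum. *)
Lemma geom_fid_blockdiag F G : (forall x, psdmx (F x)) ->
  (forall x, psdmx (G x)) ->
  geom_fid (blockdiag F) (blockdiag G) = \sum_x geom_fid (F x) (G x).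
Proof.
move=> pF pG; apply: geom_fid_eq => [||e e0|d d0].
- exact: blockdiag_psd.
- exact: blockdiag_psd.
- rewrite fid_eps_blockdiag //; apply: ler_sum => x _; exact: geom_fid_le.
have d0' : 0 < d / #|X|.+1%:R by rewrite divr_gt0.
have [e e0 he] := geom_fid_adherent_all pF pG d0'.
exists e => //; rewrite fid_eps_blockdiag //.
apply: le_trans (ler_sum _ (fun x _ => he x)) _.
rewrite big_split /= lerD2l sumr_const -[leLHS]mulr_natr -mulrA ler_piMr ?(ltW
  d0) //.
by rewrite mulrC ler_pdivrMr ?mul1r ?ler_nat.
Qed.

Lemma cq_stateE p (F : X -> 'M[C]_n) :
  cq_state ket p F = blockdiag (fun x => (p x)%:C *: F x).
Proof. by apply: eq_bigr => x _; rewrite tensmxZr. Qed.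

Lemma geom_fid_cq p (F G : X -> 'M[C]_n) : is_distribution p -> (forall x,
  is_state (F x)) ->
  (forall x, is_state (G x)) ->
  geom_fid (cq_state ket p F) (cq_state ket p G) =
  \sum_x p x * geom_fid (F x) (G x).
Proof.
move=> [p0 _] sF sG; have p0' x : 0 <= (p x)%:C by rewrite ler0c.
have pF x : psdmx (F x) by case: (sF x).
have pG x : psdmx (G x) by case: (sG x).
rewrite !cq_stateE geom_fid_blockdiag => [|x|x]; last 2 first.
- exact: psdmxZ (p0' x) (pF x).
- exact: psdmxZ (p0' x) (pG x).
by apply: eq_bigr => x _; rewrite geom_fidZ.
Qed.

End Blocks.
End DirectSum.

(** * Commuting states and the classical formula *)

Section Classical.
Variable R : realType.
Local Notation C := R[i].
Local Open Scope complex_scope.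

Section Diag.
Variables (n : nat) (U : 'M[C]_n).
Hypothesis UP : U \is unitarymx.

Let UV : U *m adjmx U = 1%:M. Proof. exact/unitarymxP. Qed.
Let VU : adjmx U *m U = 1%:M. Proof. exact/mulmx1C. Qed.

Definition udiag (a : 'I_n -> R) : 'M[C]_n :=
  U *m diag_mx (\row_x (a x)%:C) *m adjmx U.

Lemma udiagM a b : udiag a *m udiag b = udiag (fun x => a x * b x).
Proof.
rewrite /udiag !mulmxA -(mulmxA _ (adjmx U) U) VU mulmx1 -(mulmxA U) mulmx_diag.
congr (_ *m diag_mx _ *m _); apply/rowP => x; by rewrite !mxE rmorphM.
Qed.

Lemma udiag_const (c : R) : udiag (fun=> c) = c%:C%:M.
Proof.
rewrite /udiag (_ : \row_x _ = const_mx c%:C); last by apply/rowP => x;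
  rewrite !mxE.
by rewrite diag_const_mx mul_mx_scalar -scalemxAl UV scalemx1.
Qed.

Lemma udiagD a b : udiag a + udiag b = udiag (fun x => a x + b x).
Proof.
rewrite /udiag -mulmxDl -mulmxDr -linearD; congr (_ *m diag_mx _ *m _).
by apply/rowP => x; rewrite !mxE rmorphD.
Qed.

Lemma udiag_psd a : (forall x, 0 <= a x) -> psdmx (udiag a).
Proof.
move=> a0; rewrite /udiag -{1}[U]adjmxK; apply/psdmx_conj/psdmx_diag => x.
by rewrite mxE ler0c.
Qed.

Lemma mxtrace_udiag a : \tr (udiag a) = \sum_x (a x)%:C.
Proof.
rewrite /udiag mxtrace_mulC mulmxA VU mul1mx mxtrace_diag.
by apply: eq_bigr => x _; rewrite mxE.
Qed.

Lemma eq_udiag a b : a =1 b -> udiag a = udiag b.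
Proof. by move=> ab; congr udiag; apply/funext. Qed.

(** The Riccati equation reduces to the scalar identity sqrt(a b) a^-1 sqrt(a b) = b. *)
Lemma geomeanmx_udiag a b : (forall x, 0 < a x) -> (forall x, 0 < b x) ->
  geomeanmx (udiag a) (udiag b) = udiag (fun x => Num.sqrt (a x * b x)).
Proof.
move=> a0 b0.
have e : udiag a *m udiag (fun x => (a x)^-1) = 1%:M.
  rewrite udiagM (_ : 1%:M = (1 : R)%:C%:M) // -udiag_const;
    apply: eq_udiag => x.
  by rewrite divff // gt_eqF.
have [u _] := mulmx1_unit e.
have iE : invmx (udiag a) = udiag (fun x => (a x)^-1).
  by apply: (can_inj (mulKmx u)); rewrite e mulmxV.
apply: geomeanmx_uniq.
- by split=> //; apply: udiag_psd => x; exact: ltW.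
- by apply: udiag_psd => x; exact: ltW.
- by apply: udiag_psd => x; exact: sqrtr_ge0.
rewrite iE !udiagM; apply: eq_udiag => x.
rewrite mulrAC -expr2 sqr_sqrtr ?mulr_ge0 ?ltW //.
by rewrite mulrAC divff ?mul1r // gt_eqF.
Qed.

Lemma fid_eps_udiag a b e : (forall x, 0 <= a x) -> (forall x, 0 <= b x) ->
  0 < e -> fid_eps (udiag a) (udiag b) e =
    \sum_x Num.sqrt ((a x + e) * (b x + e)).
Proof.
move=> a0 b0 e0; rewrite /fid_eps -udiag_const !udiagD.
rewrite geomeanmx_udiag => [|x|x]; try by rewrite ltr_wpDl.
by rewrite mxtrace_udiag Re_sum.
Qed.

Lemma geom_fid_udiag a b : (forall x, 0 <= a x <= 1) ->
  (forall x, 0 <= b x <= 1) ->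
  geom_fid (udiag a) (udiag b) = \sum_x Num.sqrt (a x * b x).
Proof.
move=> a01 b01.
have a0 x : 0 <= a x by case/andP: (a01 x).
have b0 x : 0 <= b x by case/andP: (b01 x).
apply: geom_fid_eq => [||e e0|d d0].
- exact: udiag_psd.
- exact: udiag_psd.
- rewrite fid_eps_udiag //; apply: ler_sum => x _; apply: ler_wsqrtr.
  have e0' := ltW e0.
  by apply: ler_pM => //; rewrite lerDl.
pose d' := d / n.+1%:R; have d'0 : 0 < d' by rewrite divr_gt0.
(* As a, b and e are at most 1, (a + e)(b + e) <= a b + 3 e <= a b + d'^2, which is at most (sqrt(a
   b) + d')^2. *)
pose e : R := Num.min 1 (d' ^+ 2 / 3%:R).
have e0 : 0 < e by rewrite lt_min ltr01 divr_gt0 // exprn_gt0.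
exists e => //; rewrite fid_eps_udiag //.
have le x : Num.sqrt ((a x + e) * (b x + e)) <= Num.sqrt (a x * b x) + d'.
  have s0 := sqrtr_ge0 (a x * b x).
  rewrite -(@ger0_norm _ (Num.sqrt _ + _)); last by rewrite addr_ge0 // ltW.
  rewrite -sqrtr_sqr; apply: ler_wsqrtr.
  have e1 : e <= 1 by rewrite ge_min lexx.
  have e2 : e <= d' ^+ 2 / 3%:R by rewrite ge_min lexx orbT.
  have ee : e * e <= e by rewrite ler_piMl // ltW.
  have ae : a x * e <= e by rewrite ler_piMl ?(ltW e0) //; case/andP: (a01 x).
  have be : e * b x <= e by rewrite ler_piMr ?(ltW e0) //; case/andP: (b01 x).
  have sd : 0 <= Num.sqrt (a x * b x) * d' by rewrite mulr_ge0 // ltW.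
  have s2 : Num.sqrt (a x * b x) ^+ 2 = a x * b x by rewrite sqr_sqrtr
    ?mulr_ge0.
  rewrite sqrrD s2 mulrDl !mulrDr; lra.
apply: le_trans (ler_sum _ (fun x _ => le x)) _.
rewrite big_split /= lerD2l sumr_const card_ord -[leLHS]mulr_natr -mulrA.
rewrite ler_piMr ?(ltW d0) //.
by rewrite mulrC ler_pdivrMr ?mul1r ?ler_nat.
Qed.

End Diag.

Lemma col_mulmx m n p (A : 'M[C]_(m, n)) (B : 'M[C]_(n, p)) x :
  col x (A *m B) = A *m col x B.
Proof. by rewrite !colE mulmxA. Qed.

Lemma common_eigenbasisE r n (rho : 'I_r -> 'M[C]_n) U lambda i :
  common_eigenbasis rho U lambda -> rho i = udiag U (lambda i).
Proof.
move=> [/unitarymxP UV h].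
have e : rho i *m U = U *m diag_mx (\row_x (lambda i x)%:C).
  apply/matrixP => k x; have /colP/(_ k) := h i x.
  rewrite -col_mulmx mul_mx_diag !mxE => ->; exact: mulrC.
by rewrite /udiag -e -mulmxA UV mulmx1.
Qed.

(** The a x are the diagonal entries of U^* rho U, hence nonnegative, and the trace makes them sum
    to 1. *)
Lemma state_udiag n (U : 'M[C]_n) (a : 'I_n -> R) : U \is unitarymx ->
  is_state (udiag U a) -> forall x, 0 <= a x <= 1.
Proof.
move=> uU [pA tA].
have VU : adjmx U *m U = 1%:M by apply: mulmx1C; exact/unitarymxP.
have a0 x : 0 <= a x.
  have := psdmx_ge0 (delta_mx x 0) (psdmx_conj U pA).
  rewrite /udiag !mulmxA VU mul1mx -mulmxA VU mulmx1 /qform.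
  by rewrite adjmx_delta -rowE -colE !mxE eqxx mulr1n ler0c.
move=> x; rewrite a0 /=.
move: tA; rewrite mxtrace_udiag // -rmorph_sum /= => -[<-].
by rewrite (bigD1 x) //= lerDl sumr_ge0.
Qed.

(** A commuting family is triangularised by one unitary; a triangular Hermitian matrix is diagonal
    with real entries. *)
Lemma commuting_eigenbasis r n (rho : 'I_r -> 'M[C]_n) :
  (forall i, is_state (rho i)) -> (forall i j, comm_mx (rho i) (rho j)) ->
  exists (U : 'M[C]_n) (lambda : 'I_r -> 'I_n -> R),
    common_eigenbasis rho U lambda.
Proof.
move=> st cm; have [|P uP /allP trig] := @cotrigonalization C n [seq rho i | i :
  'I_r].
  by move=> A B /mapP[i _ ->] /mapP[j _ ->].
pose D i := P *m rho i *m adjmx P.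
have VP : adjmx P *m P = 1%:M by apply: mulmx1C; exact/unitarymxP.
have hD i : adjmx (D i) = D i.
  by rewrite /D !adjmxM adjmxK mulmxA psdmx_herm //; case: (st i).
have dD i : D i = diag_mx (\row_x (complex.Re (D i x x))%:C).
  have tD : is_trig_mx (D i).
    by rewrite /D -conjymx //; apply/trig/map_f; rewrite mem_enum.
  have cD k l : D i k l = (D i l k)^*%R by rewrite -{1}hD !mxE.
  apply/matrixP => k l; rewrite [RHS]mxE [in RHS]mxE;
    case: (eqVneq k l) => [->|kl].
    by rewrite mulr1n RRe_real //; apply/CrealP; exact/esym/cD.
  have [lt|lt|/val_inj e] := ltngtP k l; last by rewrite e eqxx in kl.
    by move/is_trig_mxP: tD => /(_ _ _ lt) ->.
  by rewrite cD; move/is_trig_mxP: tD => /(_ _ _ lt) ->; rewrite conjC0.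
exists (adjmx P), (fun i x => complex.Re (D i x x)); split.
  by apply/unitarymxP; rewrite -/(adjmx _) adjmxK.
move=> i x.
have e : rho i *m adjmx P = adjmx P *m D i.
  by rewrite /D !mulmxA VP mul1mx.
rewrite -col_mulmx e [in LHS]dD; apply/colP => k.
by rewrite mul_mx_diag !mxE mulrC.
Qed.

End Classical.

(** * Averages over pairs *)

Section Average.
Variable R : realType.
Local Notation C := R[i].

(** Ordered pairs of distinct indices, unlike pairs i < j, are stable under permutations and easy to
    count. *)
Lemma sum_pairs_sym r (g : 'I_r -> 'I_r -> R) : (forall i j, g i j = g j i) ->
  2 * (\sum_(i < r) \sum_(j < r | (i < j)%N) g i j) =
  \sum_(i < r) \sum_(j < r | j != i) g i j.
Proof.
move=> gC; rewrite mulr_natl mulr2n.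
have {2}-> : \sum_(i < r) \sum_(j < r | (i < j)%N) g i j =
    \sum_(i < r) \sum_(j < r | (j < i)%N) g i j.
  rewrite (exchange_big_dep xpredT) //=; apply: eq_bigr => i _.
  by apply: eq_bigr => j _.
rewrite -big_split; apply: eq_bigr => i _ /=.
rewrite [RHS](bigID (fun j : 'I_r => (i < j)%N)) /=; congr (_ + _).
  by apply: eq_bigl => j; rewrite -val_eqE; case: ltngtP.
by apply: eq_bigl => j; rewrite -val_eqE -leqNgt; case: ltngtP.
Qed.

Lemma sum_pairs_perm r (g : 'I_r -> 'I_r -> R) (s : 'S_r) :
  (forall i j, g i j = g j i) ->
  \sum_(i < r) \sum_(j < r | (i < j)%N) g (s i) (s j) =
  \sum_(i < r) \sum_(j < r | (i < j)%N) g i j.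
Proof.
move=> gC; have two0 : (2 : R) != 0 by rewrite pnatr_eq0.
apply: (mulfI two0); rewrite (sum_pairs_sym gC) sum_pairs_sym //.
rewrite [RHS](reindex_inj (@perm_inj _ s)) /=; apply: eq_bigr => i _.
rewrite [RHS](reindex_inj (@perm_inj _ s)) /=; apply: eq_bigl => j.
by rewrite (inj_eq (@perm_inj _ s)).
Qed.

Lemma sum_pairs_const r (c : R) : (0 < r)%N ->
  2 * (\sum_(i < r) \sum_(j < r | (i < j)%N) c) = r%:R * (r%:R - 1) * c.
Proof.
move=> r0; rewrite sum_pairs_sym //.
under eq_bigr do rewrite sumr_const cardC1 card_ord.
by rewrite sumr_const card_ord -[LHS]mulr_natl -[c *+ _]mulr_natl mulrA -subn1
  natrB.
Qed.

(** The graph of x^(k+1) lies above its tangent at m. In the induction, x times the bound for k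
    exceeds the bound for k + 1 by (k + 1) m^k (x - m)^2. *)
Lemma expr_tangent (x m : R) k : 0 <= x -> 0 <= m ->
  m ^+ k.+1 + k.+1%:R * m ^+ k * (x - m) <= x ^+ k.+1.
Proof.
move=> x0 m0; elim: k => [|k IH].
  by rewrite !expr1 expr0 mulr1 mul1r addrC subrK.
have := ler_wpM2l x0 IH; rewrite -exprS; apply: le_trans.
rewrite -subr_ge0 (_ : _ - _ = m ^+ k * (k.+1%:R * (x - m) ^+ 2)).
  by rewrite mulr_ge0 ?exprn_ge0 // mulr_ge0 ?sqr_ge0.
by rewrite !exprS -!natr1; ring.
Qed.

Section Weight.
Variables (r : nat) (hr : (2 <= r)%N).
Let w : R := 2 / (r%:R * (r%:R - 1)).

Lemma pairs_gt0 : 0 < r%:R * (r%:R - 1) :> R.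
Proof.
by rewrite mulr_gt0 ?subr_gt0 ?ltr1n ?ltr0n //; apply: leq_trans hr.
Qed.

Lemma weight_gt0 : 0 < w.
Proof. by rewrite divr_gt0 ?pairs_gt0. Qed.

Lemma weight_sum c : w * (\sum_(i < r) \sum_(j < r | (i < j)%N) c) = c.
Proof.
rewrite /w mulrAC sum_pairs_const; last exact: leq_trans hr.
by rewrite mulrAC divff ?mul1r // gt_eqF ?pairs_gt0.
Qed.

(** The tangent inequality at the mean m is averaged over the pairs; the linear term averages to
    0. *)
Lemma jensen_pairs (f : 'I_r -> 'I_r -> R) k :
  (forall i j, 0 <= f i j) ->
  (w * \sum_(i < r) \sum_(j < r | (i < j)%N) f i j) ^+ k.+1 <=
  w * \sum_(i < r) \sum_(j < r | (i < j)%N) f i j ^+ k.+1.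
Proof.
move=> f0; set m := w * _.
have m0 : 0 <= m.
  rewrite mulr_ge0 ?(ltW weight_gt0) // sumr_ge0 // => i _; exact: sumr_ge0.
have h : w * (\sum_(i < r) \sum_(j < r | (i < j)%N)
      (m ^+ k.+1 + k.+1%:R * m ^+ k * (f i j - m))) <=
    w * \sum_(i < r) \sum_(j < r | (i < j)%N) f i j ^+ k.+1.
  rewrite (ler_pM2l weight_gt0); apply: ler_sum => i _; apply: ler_sum => j _.
  exact: expr_tangent.
apply: le_trans h.
rewrite (_ : \sum_(i < r) _ = \sum_(i < r) \sum_(j < r | (i < j)%N) m ^+ k.+1
    + k.+1%:R * m ^+ k * (\sum_(i < r) \sum_(j < r | (i < j)%N) f i j
                        - \sum_(i < r) \sum_(j < r | (i < j)%N) m)); last first.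
  rewrite -sumrB mulr_sumr -big_split; apply: eq_bigr => i _ /=.
  by rewrite -sumrB mulr_sumr -big_split.
by rewrite mulrDr weight_sum mulrCA mulrBr -/m weight_sum subrr mulr0 addr0.
Qed.

End Weight.

(** The pairs that involve one of the last m indices contribute nonnegative terms, which are
    dropped. *)
Lemma sum_pairs_lshift r m (g : 'I_(r + m) -> 'I_(r + m) -> R) :
  (forall i j, 0 <= g i j) ->
  \sum_(i < r) \sum_(j < r | (i < j)%N) g (lshift m i) (lshift m j) <=
  \sum_(i < r + m) \sum_(j < r + m | (i < j)%N) g i j.
Proof.
move=> g0; rewrite [leRHS]big_split_ord /= -[leLHS]addr0; apply: lerD.
  apply: ler_sum => i _; rewrite [leRHS]big_split_ord /= lerDl.
  exact: sumr_ge0.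
by apply: sumr_ge0 => i _; apply: sumr_ge0.
Qed.

Lemma avg_geom_fidE r n (rho : 'I_r -> 'M[C]_n) : avg_geom_fid rho =
  2 / (r%:R * (r%:R - 1)) *
  \sum_(i < r) \sum_(j < r | (i < j)%N) geom_fid (rho i) (rho j).
Proof. by []. Qed.

(** If the average is 1, the nonnegative defects 1 - F_G have average 0, so each vanishes and the
    pairwise statement applies. *)
Lemma avg_geom_fid_eq1 r n (rho : 'I_r -> 'M[C]_n) : (2 <= r)%N ->
  (forall i, is_state (rho i)) ->
  (avg_geom_fid rho = 1 <-> forall i j, rho i = rho j).
Proof.
move=> hr st; rewrite avg_geom_fidE; split=> [h|h].
  have def : \sum_(i < r) \sum_(j < r | (i < j)%N)
      (1 - geom_fid (rho i) (rho j)) = 0.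
    apply: (mulfI (lt0r_neq0 (weight_gt0 hr))); rewrite mulr0.
    under eq_bigr do rewrite sumrB.
    by rewrite sumrB mulrBr weight_sum // h subrr.
  have d0 i j : 0 <= 1 - geom_fid (rho i) (rho j).
    by rewrite subr_ge0; exact: geom_fid_le1.
  have lt_eq (i j : 'I_r) : (i < j)%N -> rho i = rho j.
    move=> ij; apply: geom_fid_eq1 => //; apply/eqP; rewrite eq_sym -subr_eq0.
    have hi := psumr_eq0P (fun k _ => sumr_ge0 _ (fun l _ => d0 k l)) def.
    by rewrite (psumr_eq0P (fun l _ => d0 i l) (hi i isT) ij).
  by move=> i j; have [/lt_eq|/lt_eq|/val_inj->] := ltngtP i j.
under eq_bigr => i _ do under eq_bigr => j _ do
  rewrite (h j i) (geom_fid_id (proj1 (st i))) (proj2 (st i)) /=.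
exact: weight_sum.
Qed.

End Average.

Theorem mainTheorem18
 (R : realType) (r : nat) (hr : (2 <= r)%N) :
  (* Reduction to classical *)
  (forall (n : nat) (rho : 'I_r -> 'M[R[i]]_n),
     (forall i, is_state (rho i)) ->
     (forall i j, comm_mx (rho i) (rho j)) ->
     (exists (U : 'M[R[i]]_n) (lambda : 'I_r -> 'I_n -> R),
        common_eigenbasis rho U lambda) /\
     (forall (U : 'M[R[i]]_n) (lambda : 'I_r -> 'I_n -> R),
        common_eigenbasis rho U lambda ->
        avg_geom_fid rho =
        2 / (r%:R * (r%:R - 1)) *
        \sum_(i < r) \sum_(j < r | (i < j)%N)
          \sum_(x < n) Num.sqrt (lambda i x * lambda j x))) /\
  (* Data processing *)
  (forall (n m : nat) (rho : 'I_r -> 'M[R[i]]_n)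
          (N : {linear 'M[R[i]]_n -> 'M[R[i]]_m}),
     (forall i, is_state (rho i)) ->
     is_channel N ->
     avg_geom_fid rho <= avg_geom_fid (fun i => N (rho i))) /\
  (* Symmetry *)
  (forall (n : nat) (rho : 'I_r -> 'M[R[i]]_n) (pi : 'S_r),
     (forall i, is_state (rho i)) ->
     avg_geom_fid rho = avg_geom_fid (fun i => rho (pi i))) /\
  (* Faithfulness *)
  (forall (n : nat) (rho : 'I_r -> 'M[R[i]]_n),
     (forall i, is_state (rho i)) ->
     (avg_geom_fid rho = 1 <-> forall i j, rho i = rho j)) /\
  (* Direct-sum property *)
  (forall (n : nat) (X : finType) (ket : X -> 'cV[R[i]]_#|X|) (p : X -> R)
          (rho : 'I_r -> X -> 'M[R[i]]_n),
     orthonormal_basis ket ->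
     is_distribution p ->
     (forall i x, is_state (rho i x)) ->
     avg_geom_fid (fun i => cq_state ket p (rho i)) =
     \sum_x p x * avg_geom_fid (fun i => rho i x)) /\
  (* Super-multiplicativity *)
  (forall (n : nat) (rho : 'I_r -> 'M[R[i]]_n) (k : nat),
     (forall i, is_state (rho i)) ->
     (1 <= k)%N ->
     avg_geom_fid rho ^+ k <=
     avg_geom_fid (fun i => ntensmx (rho i) k)) /\
  (* Coarse-graining *)
  (forall (n m : nat) (rho : 'I_(r + m) -> 'M[R[i]]_n),
     (forall i, is_state (rho i)) ->
     avg_geom_fid (fun i : 'I_r => rho (lshift m i)) <=
     ((r + m)%:R * ((r + m)%:R - 1)) / (r%:R * (r%:R - 1)) *
     avg_geom_fid rho).

Proof.
have psd n (rho : 'M[R[i]]_n) : is_state rho -> psdmx rho by case.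
split; [|split; [|split; [|split; [|split; [|split]]]]].
- move=> n rho st cm; split; first exact: commuting_eigenbasis.
  move=> U lambda he; rewrite avg_geom_fidE; congr (_ * _).
  have uU : U \is unitarymx by case: he.
  apply: eq_bigr => i _; apply: eq_bigr => j _.
  have le01 k x : 0 <= lambda k x <= 1.
    by apply: (state_udiag uU); rewrite -(common_eigenbasisE k he).
  by rewrite !(common_eigenbasisE _ he) geom_fid_udiag.
- move=> n m rho N st chN; rewrite !avg_geom_fidE (ler_pM2l (weight_gt0 R hr)).
  apply: ler_sum => i _; apply: ler_sum => j _.
  exact: geom_fid_channel chN (psd _ _ (st i)) (psd _ _ (st j)).
- move=> n rho pi st; rewrite /avg_geom_fid.
  have := fun i j => geom_fidC (psd _ _ (st i)) (psd _ _ (st j)).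
  move: (@geom_fid R n) => F FC; congr (_ * _).
  exact: esym (sum_pairs_perm pi FC).
- by move=> n rho st; apply: avg_geom_fid_eq1.
- move=> n X ket p rho ketP dp st; rewrite avg_geom_fidE.
  (* The weight of the average is pulled out of the sum over X, which is then exchanged with the two
     sums over indices. *)
  under [RHS]eq_bigr do rewrite avg_geom_fidE mulrCA.
  rewrite -mulr_sumr; congr (_ * _).
  under [RHS]eq_bigr do rewrite mulr_sumr.
  rewrite [RHS]exchange_big; apply: eq_bigr => i _ /=.
  under [RHS]eq_bigr do rewrite mulr_sumr.
  rewrite [RHS]exchange_big; apply: eq_bigr => j _ /=.
  exact: geom_fid_cq.
- move=> n rho [//|k] st _; rewrite !avg_geom_fidE.
  apply: le_trans (jensen_pairs hr k _) _ => [i j|].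
    by apply: geom_fid_ge0; apply: psd.
  rewrite (ler_pM2l (weight_gt0 R hr)).
  apply: ler_sum => i _; apply: ler_sum => j _; exact: geom_fid_ntens.
- move=> n m rho st; rewrite !avg_geom_fidE.
  have hrm : (2 <= r + m)%N := leq_trans hr (leq_addr m r).
  have := pairs_gt0 R hr; have := pairs_gt0 R hrm.
  set a := r%:R * _; set b := (r + m)%:R * _ => b0 a0.
  (* The coarse-graining factor b / a turns the weight for r + m states into the weight for r
     states, so only the two sums remain to be compared. *)
  rewrite mulrA (_ : b / a * (2 / b) = 2 / a); last first.
    by field; rewrite !gt_eqF.
  rewrite ler_pM2l ?divr_gt0 //.
  apply: (sum_pairs_lshift (g := fun i j => geom_fid (rho i) (rho j))) => i j.
  by apply: geom_fid_ge0; apply: psd.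
Qed.
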